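(* There exist absolute constants $c>0$ and $n_0\in\mathbb{N}$ such that for every $n\geq n_0$ and every log-concave probability measure $\mu$ on $\mathbb{R}^n$, $$\mathbb{E}_{\mu}(\varphi_{\mu}):=\int_{\mathbb{R}^n}\varphi_{\mu}(x)\,d\mu(x)\leq \exp\left(-cn/L_{\mu}^2\right),$$ where $L_\mu$ is the isotropic constant of $\mu$.
   Context: A log-concave probability measure on $\mathbb{R}^n$ is a Borel probability measure $\mu$ such that $\mu(\lambda A+(1-\lambda)B)\geq \mu(A)^{\lambda}\mu(B)^{1-\lambda}$ for all compact $A,B\subseteq\mathbb{R}^n$ and $\lambda\in(0,1)$, and $\mu(H)<1$ for every hyperplane $H$; such a measure has a log-concave density $f_\mu$. Tukey's half-space depth is $\varphi_\mu(x)=\inf\{\mu(H): H\in\mathcal{H}(x)\}$, where $\mathcal{H}(x)$ is the set of all half-spaces of $\mathbb{R}^n$ containing $x$. The isotropic constant is $L_\mu=\left(\sup_{x} f_\mu(x)\right)^{1/n}[\det \mathrm{Cov}(\mu)]^{1/(2n)}$, where $\mathrm{Cov}(\mu)$ is the covariance matrix of $\mu$. *)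

(* Defs.v *)
(* R^n is modelled as [n.-tuple R],
   which carries MathComp-Analysis's product (= Borel) sigma-algebra. *)
From mathcomp Require Import all_boot all_order all_algebra.
From mathcomp Require Import all_classical all_reals all_analysis.
Import numFieldNormedType.Exports.
Import Order.TTheory GRing.Theory Num.Theory.

Set Implicit Arguments.
Unset Strict Implicit.
Unset Printing Implicit Defensive.

Local Open Scope classical_set_scope.
Local Open Scope ring_scope.

Section Defs.
Variables (R : realType) (n : nat).

Definition vec := n.-tuple R.

Definition dotp (u y : vec) : R := \sum_(i < n) tnth u i * tnth y i.

Definition nonzero_vec (u : vec) : Prop := exists i : 'I_n, tnth u i != 0.

Definition comb (l : R) (a b : vec) : vec :=
  [tuple l * tnth a i + (1 - l) * tnth b i | i < n].

Definition mink (l : R) (A B : set vec) : set vec :=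
  [set z | exists a b, A a /\ B b /\ z = comb l a b].

(* transport to row vectors, to use the standard topology of R^n *)
Definition to_rV (x : vec) : 'rV[R]_n := \row_(i < n) tnth x i.

Definition compact_set (A : set vec) : Prop := compact (to_rV @` A).

Definition is_hyperplane (H : set vec) : Prop :=
  exists u t, nonzero_vec u /\ H = [set y | dotp u y = t].

Definition is_halfspace (H : set vec) : Prop :=
  exists u t, nonzero_vec u /\ H = [set y | t <= dotp u y].

Definition box (a b : vec) : set vec :=
  [set x | forall i : 'I_n, tnth a i <= tnth x i <= tnth b i].

(* [leb] is the Lebesgue measure on the Borel sets of R^n: it gives every
   box its volume (this determines it uniquely). *)
Definition is_lebesgue (leb : {measure set vec -> \bar R}) : Prop :=
  forall a b : vec, (forall i : 'I_n, tnth a i <= tnth b i) ->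
    leb (box a b) = (\prod_(i < n) (tnth b i - tnth a i))%:E.

Definition log_concave_measure (mu : probability vec R) : Prop :=
  (forall (A B : set vec) (l : R), compact_set A -> compact_set B ->
     0 < l < 1 ->
     (fine (mu A)) `^ l * (fine (mu B)) `^ (1 - l) <= fine (mu (mink l A B)))
  /\ (forall H, is_hyperplane H -> (mu H < 1)%E).

Definition log_concave_fun (f : vec -> R) : Prop :=
  (forall x, 0 <= f x) /\
  (forall x y (l : R), 0 < l < 1 ->
     (f x) `^ l * (f y) `^ (1 - l) <= f (comb l x y)).

Definition is_density (leb : {measure set vec -> \bar R})
    (mu : probability vec R) (f : vec -> R) : Prop :=
  (forall x, 0 <= f x) /\ measurable_fun setT f /\
  (forall A, measurable A -> mu A = (\int[leb]_(x in A) (f x)%:E)%E).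

Definition tukey_depth (mu : probability vec R) (x : vec) : \bar R :=
  ereal_inf [set mu H | H in [set H | is_halfspace H /\ H x]].

Definition mean (mu : probability vec R) (i : 'I_n) : R :=
  fine (\int[mu]_x (tnth x i)%:E)%E.

Definition cov (mu : probability vec R) : 'M[R]_n :=
  \matrix_(i < n, j < n)
    (fine (\int[mu]_x (tnth x i * tnth x j)%:E)%E - mean mu i * mean mu j).

(* isotropic constant, computed from the (log-concave) density f of mu *)
Definition isotropic_constant (mu : probability vec R) (f : vec -> R) : R :=
  (sup (range f)) `^ (n%:R^-1) * (\det (cov mu)) `^ ((2 * n)%:R^-1).

End Defs.

(* Main.v *)
(* Let K = 2^j and let F be the density of the sum of K independent copies of a
   vector with law mu; by Prekopa-Leindler F is log-concave.  If F(K x) is below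
   e^(-4n) F(p), then K x can be separated from a level set of F by a half-space
   whose F-mass is at most e^(-n); since that mass is at least mu(H)^K for the
   corresponding half-space H through x, the depth of x is at most e^(-n/K).
   The other points x satisfy F(K x) >= e^(-4n) F(p), so they have Lebesgue measure
   at most K^(-n) e^(4n) / F(p), hence mu-measure at most (sup f) times this.
   Testing F against the Gaussian with covariance K Cov(mu) yields a p with
   F(p) >= C^(-n) K^(-n/2) det(Cov mu)^(-1/2), which bounds that mu-measure by
   (C' L / sqrt K)^n.  Taking K of order L^2 makes it at most e^(-n), and the
   expected depth is then at most 2 e^(-n/K).  When n / L^2 is bounded, the depth
   being at most 1/2 everywhere suffices. *)
Require Import Defs.
From HB Require Import structures.
From mathcomp Require Import all_boot all_order all_algebra.
From mathcomp Require Import all_classical all_reals all_analysis.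
From mathcomp Require Import measurable_realfun.
From mathcomp Require Import ring lra.
Import numFieldNormedType.Exports.
Import Order.TTheory GRing.Theory Num.Theory.
Local Open Scope classical_set_scope.
Local Open Scope ring_scope.
Set Implicit Arguments.
Unset Strict Implicit.
Unset Printing Implicit Defensive.

(** * Lebesgue measure on tuples *)

(** The square of L comes from two rates in K: dilating by K shrinks volumes by K^(-n), while the
    peak of F decreases only like K^(-n/2). The remaining gain K^(-n/2) has to absorb (sup f)
    det(Cov mu)^(1/2) = L^n, hence K of order L^2, and this K is the one in e^(-n/K). K is a power
    of two because the sum arises by convolving a density with itself j times. The level e^(-4n) is
    e^(-2s) with s = 2n: the mass below e^(-2s) F(p) is at most 2^n e^(-s), and 2^n e^(-2n) <=
    e^(-n). Two points need care. The depth is an infimum over an uncountable family, so its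
    integral is estimated by monotonicity alone. Mean and covariance are defined through [fine], so
    second moments must first be shown finite; this too follows from Prekopa-Leindler, through tail
    decay. *)

Section lebesgue_tuple.
Context {R : realType}.

Definition vcons n (p : measurableTypeR R * vec R n) : vec R n.+1 :=
  [tuple of p.1 :: p.2].

Definition vuncons n (x : vec R n.+1) : measurableTypeR R * vec R n :=
  (thead x, [tuple of behead x]).

Lemma vconsK n : cancel (@vcons n) (@vuncons n).
Proof. by case=> a b; congr (_, _); apply/val_inj. Qed.

Lemma vunconsK n : cancel (@vuncons n) (@vcons n).
Proof. by move=> x; rewrite /vcons/= -tuple_eta. Qed.

Lemma measurable_vcons n : measurable_fun setT (@vcons n).
Proof. exact: measurable_cons. Qed.

Lemma measurable_vuncons n : measurable_fun setT (@vuncons n).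
Proof.
apply/measurable_fun_pair => /=; last exact: measurable_behead.
exact: measurable_tnth.
Qed.

Section step.
Variables (n : nat) (P : {sigma_finite_measure set (vec R n) -> \bar R}).

Let L : {sigma_finite_measure set (measurableTypeR R) -> \bar R} :=
  @lebesgue_measure R.
Let prodP : {measure set (measurableTypeR R * vec R n)%type -> \bar R} :=
  (L \x P)%E.

Definition leb_step : set (vec R n.+1) -> \bar R := pushforward prodP (@vcons n).

HB.instance Definition _ := Measure.copy leb_step
  (measure_function_pushforward__canonical__measure_function_Measure
    prodP (@measurable_vcons n)).

Let leb_step_sigma_finite : sigma_finite setT leb_step.
Proof.
have /sigma_finiteP[F [FT ndF Foo]] := sigma_finiteT L.
have /sigma_finiteP[G [GT ndG Goo]] := sigma_finiteT P.
exists (fun k => @vuncons n @^-1` (F k `*` G k)).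
  rewrite -preimage_bigcup (_ : \bigcup_k _ = setT) ?preimage_setT//.
  rewrite -setXTT FT GT predeqE => -[x y]; split.
    by move=> [k _ []/= Fx Gy]; split; exists k.
  move=> [/= [i _ Fx] [k _ Gy]]; exists (maxn i k) => //; split.
    by move: x Fx; exact/subsetPset/ndF/leq_maxl.
  by move: y Gy; exact/subsetPset/ndG/leq_maxr.
move=> k; have [mF Fk] := Foo k; have [mG Gk] := Goo k; split.
  rewrite -[X in measurable X]setTI; apply: measurable_vuncons => //.
  exact: measurableX.
rewrite /leb_step /pushforward -comp_preimage.
rewrite (_ : _ \o _ = id); last exact/funext/vconsK.
rewrite preimage_id.
have -> : prodP (F k `*` G k) = (L (F k) * P (G k))%E.
  exact: product_measure1E.
by rewrite lte_mul_pinfty// ge0_fin_numE.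
Qed.

HB.instance Definition _ :=
  @Measure_isSigmaFinite.Build _ _ _ leb_step leb_step_sigma_finite.

Lemma integral_leb_step (f : vec R n.+1 -> \bar R) :
  measurable_fun setT f -> (forall x, 0 <= f x)%E ->
  (\int[leb_step]_x f x =
   \int[@lebesgue_measure R]_s \int[P]_z f (vcons (s, z)))%E.
Proof.
move=> mf f0; rewrite ge0_integral_pushforward//; last exact: measurable_vcons.
rewrite fubini_tonelli1//.
  by apply: measurableT_comp => //; exact: measurable_vcons.
by move=> x; exact: f0.
Qed.

Lemma integral_leb_step_swap (f : vec R n.+1 -> \bar R) :
  measurable_fun setT f -> (forall x, 0 <= f x)%E ->
  (\int[leb_step]_x f x =
   \int[P]_z \int[@lebesgue_measure R]_s f (vcons (s, z)))%E.
Proof.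
move=> mf f0; rewrite ge0_integral_pushforward//; last exact: measurable_vcons.
rewrite fubini_tonelli2//.
  by apply: measurableT_comp => //; exact: measurable_vcons.
by move=> x; exact: f0.
Qed.

End step.

(** Each step forms a product measure and needs sigma-finiteness of the previous one, so the
    recursion carries that structure along. In dimension 0 the only point has mass 1. *)
Fixpoint lebn n : {sigma_finite_measure set (vec R n) -> \bar R} :=
  match n with
  | 0 => @dirac _ (vec R 0) [tuple] R
  | m.+1 => leb_step (lebn m)
  end.

Lemma integral_lebn0 (f : vec R 0 -> \bar R) :
  measurable_fun setT f -> (\int[lebn 0]_x f x = f [tuple])%E.
Proof. by move=> mf; rewrite /= integral_dirac// diracT mul1e. Qed.

Lemma integral_lebnS n (f : vec R n.+1 -> \bar R) :
  measurable_fun setT f -> (forall x, 0 <= f x)%E ->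
  (\int[lebn n.+1]_x f x =
   \int[@lebesgue_measure R]_s \int[lebn n]_z f (vcons (s, z)))%E.
Proof. exact: integral_leb_step. Qed.

(** Integrating over the head first suits completing the square and slicing along the first axis;
    the other order suits inductions closed by a one-dimensional inequality. *)
Lemma integral_lebnS_swap n (f : vec R n.+1 -> \bar R) :
  measurable_fun setT f -> (forall x, 0 <= f x)%E ->
  (\int[lebn n.+1]_x f x =
   \int[lebn n]_z \int[@lebesgue_measure R]_s f (vcons (s, z)))%E.
Proof. exact: integral_leb_step_swap. Qed.

Lemma measurable_section_snd n (f : vec R n.+1 -> \bar R) (s : R) :
  measurable_fun setT f -> measurable_fun setT (fun z => f (vcons (s, z))).
Proof.
move=> mf; apply: (measurableT_comp mf).
exact: (measurableT_comp (@measurable_vcons n) (measurable_pair1 _)).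
Qed.

Lemma measurable_integral_snd n (f : vec R n.+1 -> \bar R) :
  measurable_fun setT f -> (forall x, 0 <= f x)%E ->
  measurable_fun setT
    (fun s : measurableTypeR R => \int[lebn n]_z f (vcons (s, z)))%E.
Proof.
move=> mf f0; apply: (measurable_fun_fubini_tonelli_F (f \o @vcons n)) => //.
- by apply: (measurableT_comp mf); exact: measurable_vcons.
- by move=> x; exact: f0.
Qed.

Lemma preimage_vcons_box n (a b : vec R n.+1) :
  @vcons n @^-1` box a b = `[thead a, thead b]%classic `*`
    box [tuple of behead a] [tuple of behead b].
Proof.
apply/seteqP; split => -[s z] /=.
  move=> H; split.
    by have := H ord0; rewrite /= in_itv.
  move=> i; have := H (lift ord0 i).
  by rewrite [in tnth a](tuple_eta a) [in tnth b](tuple_eta b) !tnthS.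
rewrite in_itv/= => -[H1 H2] i.
case: (unliftP ord0 i) => [j ->|->//].
by rewrite [in tnth a](tuple_eta a) [in tnth b](tuple_eta b) !tnthS; exact: H2.
Qed.

Lemma measurable_box n (a b : vec R n) : measurable (box a b).
Proof.
rewrite (_ : box a b = \bigcap_(i in [set: 'I_n])
    ((fun x : vec R n => tnth x i) @^-1` `[tnth a i, tnth b i])); last first.
  apply/seteqP; split => x H i => [_|]; first by rewrite /= in_itv/=; exact: H.
  by have := H i I; rewrite /= in_itv.
apply: fin_bigcap_measurable => // i _.
by rewrite -[X in measurable X]setTI; exact: measurable_tnth.
Qed.

Lemma lebn_box n (a b : vec R n) : (forall i, tnth a i <= tnth b i) ->
  lebn n (box a b) = (\prod_(i < n) (tnth b i - tnth a i))%:E.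
Proof.
elim: n a b => [|n ih] a b ab.
  by rewrite big_ord0 /= diracE mem_set// => -[].
rewrite [LHS]/= /leb_step /pushforward preimage_vcons_box.
rewrite [LHS](product_measure1E (@lebesgue_measure R) (lebn n))//; last first.
  exact: measurable_box.
rewrite big_ord_recl EFinM; congr (_ * _)%E.
  rewrite [LHS](lebesgue_measure_itv `[thead a, thead b])/= lte_fin.
  have : thead a <= thead b by exact: ab.
  (* [lebesgue_measure_itv] tests strict inequality, so equal endpoints are a separate case. *)
  rewrite le_eqVlt => /predU1P[e|->]; last by rewrite -EFinB.
  rewrite e ltxx; have := e; rewrite /thead => ->.
  by rewrite subrr.
rewrite [LHS]ih; last first.
  move=> i; have := ab (lift ord0 i).
  by rewrite [in tnth a](tuple_eta a) [in tnth b](tuple_eta b) !tnthS.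
congr EFin; apply: eq_bigr => i _.
by rewrite [in RHS](tuple_eta a) [in RHS](tuple_eta b) !tnthS.
Qed.

End lebesgue_tuple.

Section vectors.
Context {R : realType} {n : nat}.
Implicit Types (x y z u : vec R n).

Definition vadd x y : vec R n := [tuple tnth x i + tnth y i | i < n].
Definition vsub x y : vec R n := [tuple tnth x i - tnth y i | i < n].

Lemma vsubK y : cancel (fun x => vsub x y) (fun x => vadd x y).
Proof.
by move=> x; apply/eq_from_tnth => i; rewrite !tnth_mktuple subrK.
Qed.

Lemma vaddK y : cancel (fun x => vadd x y) (fun x => vsub x y).
Proof.
by move=> x; apply/eq_from_tnth => i; rewrite !tnth_mktuple addrK.
Qed.

Lemma dotpD u x y : dotp u (vadd x y) = dotp u x + dotp u y.
Proof.
rewrite /dotp -big_split/=; apply: eq_bigr => i _.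
by rewrite tnth_mktuple mulrDr.
Qed.

Lemma dotp_comb u l x y :
  dotp u (comb l x y) = l * dotp u x + (1 - l) * dotp u y.
Proof.
rewrite /dotp !mulr_sumr -big_split/=; apply: eq_bigr => i _.
by rewrite tnth_mktuple; ring.
Qed.

Lemma comb_vadd l x y z : comb l (vadd x z) (vadd y z) = vadd (comb l x y) z.
Proof. by apply/eq_from_tnth => i; rewrite !tnth_mktuple; ring. Qed.

Lemma measurable_dotp u : measurable_fun setT (dotp u).
Proof.
apply: measurable_sum => i; apply: measurable_funM => //.
exact: measurable_tnth.
Qed.

Lemma measurable_halfspace u t : measurable [set y | t <= dotp u y].
Proof.
rewrite (_ : mkset _ = dotp u @^-1` `[t, +oo[%classic).
  have md := measurable_dotp u; rewrite -[X in measurable X]setTI.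
  exact: md.
by apply/seteqP; split => y /=; rewrite in_itv/= andbT.
Qed.

Definition convex_vset (C : set (vec R n)) := forall x y l, 0 < l < 1 ->
  C x -> C y -> C (comb l x y).

End vectors.

(** * Separation of a point from a convex set *)

Section separation.
Context {R : realType}.

Lemma dotp_vcons n (u : vec R n.+1) a w s z :
  u = vcons (a, w) -> dotp u (vcons (s, z)) = a * s + dotp w z.
Proof.
move=> ->; rewrite /dotp big_ord_recl; congr (_ + _).
by apply: eq_bigr => i _; rewrite !tnthS.
Qed.

Lemma comb_vcons n l s t (z w : vec R n) :
  comb l (vcons (s, z)) (vcons (t, w)) =
  vcons (l * s + (1 - l) * t, comb l z w).
Proof.
apply/eq_from_tnth => i; rewrite tnth_mktuple.
by case: (unliftP ord0 i) => [j ->|->//]; rewrite !tnthS tnth_mktuple.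
Qed.

Definition vzero n : vec R n := [tuple 0 | i < n].

Lemma dotp0v n (z : vec R n) : dotp (vzero n) z = 0.
Proof. by apply: big1 => i _; rewrite tnth_mktuple mul0r. Qed.

(** No topology on C is assumed, so the separation is weak. Induction on the dimension: a functional
    w separates the slice s = 0, and it remains to choose the coefficient a of the head. Points with
    s < 0 bound a from below and points with s > 0 from above; the bounds are compatible because a
    segment joining two such points meets the slice inside C. If C lies on one side of the slice,
    the head coordinate alone separates. *)
Let separation0 n (C : set (vec R n.+1)) : convex_vset C -> ~ C (vzero n.+1) ->
  exists2 u, nonzero_vec u & forall y, C y -> dotp u y <= 0.
Proof.
have head_only m (D : set (vec R m.+1)) a : a != 0 ->
    (forall s z, D (vcons (s, z)) -> a * s <= 0) ->
    exists2 u, nonzero_vec u & forall y, D y -> dotp u y <= 0.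
  move=> a0 Da; exists (vcons (a, vzero m)); first by exists ord0.
  move=> y; rewrite -(vunconsK y); case: (vuncons y) => s z Dy.
  by rewrite (dotp_vcons _ _ erefl) dotp0v addr0; exact: Da Dy.
have cross m (D : set (vec R m.+1)) s1 z1 s2 z2 : convex_vset D ->
    D (vcons (s1, z1)) -> D (vcons (s2, z2)) -> s1 < 0 -> 0 < s2 ->
    exists2 l, l = s2 / (s2 - s1) & D (vcons (0, comb l z1 z2)).
  move=> cD D1 D2 s10 s20; have d0 : 0 < s2 - s1 by rewrite subr_gt0 (lt_trans s10).
  exists (s2 / (s2 - s1)) => //; have := cD _ _ (s2 / (s2 - s1)) _ D1 D2.
  rewrite comb_vcons (_ : _ * s1 + _ = 0); last by field; rewrite gt_eqF.
  by apply; rewrite divr_gt0//= ltr_pdivrMr// mul1r ltrBrDl gtrDr.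
have zeroE m : vzero m.+1 = vcons (0, vzero m).
  apply/eq_from_tnth => i; rewrite tnth_mktuple.
  by case: (unliftP ord0 i) => [j ->|->//]; rewrite !tnthS tnth_mktuple.
elim: n C => [|n ih] C cC C0.
  have [[s1 [z1 [C1 s10]]]|] := pselect (exists s z, C (vcons (s, z)) /\ s < 0).
    apply: (@head_only _ _ 1); first exact: oner_neq0.
    move=> s z Cs; rewrite mul1r leNgt; apply/negP => s0.
    have [l _ Cl] := cross _ _ _ _ _ _ cC C1 Cs s10 s0.
    by apply: C0; rewrite zeroE; congr C: Cl; congr (vcons (_, _)); apply/eq_from_tnth => -[].
  move=> H; apply: (@head_only _ _ (-1)); first by rewrite oppr_eq0 oner_eq0.
  move=> s z Cs; rewrite mulN1r oppr_le0 leNgt; apply/negP => s0.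
  by apply: H; exists s, z.
have [H|] := pselect (exists s z, C (vcons (s, z)) /\ s < 0); last first.
  move=> H; apply: (@head_only _ _ (-1)); first by rewrite oppr_eq0 oner_eq0.
  move=> s z Cs; rewrite mulN1r oppr_le0 leNgt; apply/negP => s0.
  by apply: H; exists s, z.
have [[s2 [z2 [C2 s20]]]|] := pselect (exists s z, C (vcons (s, z)) /\ 0 < s); last first.
  move=> H'; apply: (@head_only _ _ 1); first exact: oner_neq0.
  move=> s z Cs; rewrite mul1r leNgt; apply/negP => s0.
  by apply: H'; exists s, z.
have [w w0 Cw] : exists2 w, nonzero_vec w & forall z, C (vcons (0, z)) -> dotp w z <= 0.
  apply: ih; last by rewrite -zeroE.
  move=> x y l l01 Cx Cy; have := cC _ _ _ l01 Cx Cy.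
  by rewrite comb_vcons !mulr0 addr0.
have slope s1 z1 t y : C (vcons (s1, z1)) -> C (vcons (t, y)) -> s1 < 0 -> 0 < t ->
    - (dotp w z1 / s1) <= - (dotp w y / t).
  move=> C1 Ct s10 t0; have [l lE /Cw] := cross _ _ _ _ _ _ cC C1 Ct s10 t0.
  have d0 : 0 < t - s1 by rewrite subr_gt0 (lt_trans s10).
  rewrite dotp_comb (_ : _ + _ = (t * dotp w z1 - s1 * dotp w y) / (t - s1)); last first.
    by rewrite lE; field; rewrite gt_eqF.
  rewrite ler_pdivrMr// mul0r subr_le0 => H1.
  rewrite lerN2 ler_pdivrMr// mulrAC ler_ndivlMr//.
  by rewrite mulrC (le_trans H1)// mulrC.
(* The lower bounds for the head coefficient; dividing by s < 0 reverses the inequality. By [slope],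
   their supremum also respects every upper bound. *)
pose S := [set a | exists s z, [/\ C (vcons (s, z)), s < 0 & a = - (dotp w z / s)]].
have hsS : has_sup S.
  have [s [z [Cs s0]]] := H; split; first by exists (- (dotp w z / s)), s, z.
  by exists (- (dotp w z2 / s2)) => _ [t [y [Ct t0 ->]]]; exact: slope.
exists (vcons (sup S, w)).
  by case: w0 => i wi; exists (lift ord0 i); rewrite tnthS.
move=> y; rewrite -(vunconsK y); case: (vuncons y) => s z Cs.
rewrite (dotp_vcons _ _ erefl); have [s0|s0|s0] := ltgtP s 0.
- have : - (dotp w z / s) <= sup S by apply: ub_le_sup hsS.2 _ _; exists s, z.
  by rewrite -mulNr ler_ndivrMr// -lerBrDr sub0r.
- have : sup S <= - (dotp w z / s).
    by apply: ge_sup; [exact: hsS.1|move=> _ [t [v [Ct t0 ->]]]; exact: slope].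
  by rewrite -mulNr ler_pdivlMr// -lerBrDr sub0r.
- by rewrite s0 mulr0 add0r; apply: Cw; rewrite -s0.
Qed.

Lemma convex_separation n (C : set (vec R n.+1)) z : convex_vset C -> ~ C z ->
  exists2 u, nonzero_vec u & forall y, C y -> dotp u y <= dotp u z.
Proof.
move=> cC Cz; have [||u u0 Cu] := @separation0 n [set y | C (vadd y z)].
- by move=> x y l l01 Cx Cy; rewrite /= -comb_vadd; exact: cC.
- rewrite /= (_ : vadd _ _ = z)//.
  by apply/eq_from_tnth => i; rewrite !tnth_mktuple add0r.
exists u => // y; rewrite -(vsubK z y) => /Cu yu.
by rewrite dotpD gerDr.
Qed.

End separation.

(** * Uniqueness of Lebesgue measure on tuples *)

Section lebesgue_unique.
Context {R : realType}.

Lemma box_setI_closed n : setI_closed (range (fun ab : vec R n * vec R n => box ab.1 ab.2)).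
Proof.
move=> _ _ [[a b] _ <-] [[c d] _ <-] /=.
exists ([tuple Num.max (tnth a i) (tnth c i) | i < n],
        [tuple Num.min (tnth b i) (tnth d i) | i < n]) => //=.
apply/seteqP; split => x /=.
  move=> H; split => i; have := H i; rewrite !tnth_mktuple ge_max le_min.
    by move=> /andP[/andP[-> _] /andP[-> _]].
  by move=> /andP[/andP[_ ->] /andP[_ ->]].
move=> [H1 H2] i; rewrite !tnth_mktuple ge_max le_min.
by have /andP[-> ->] := H1 i; have /andP[-> ->] := H2 i.
Qed.

Lemma bigcup_box n :
  \bigcup_k box (nseq_tuple n (- k%:R)) (nseq_tuple n k%:R) = [set: vec R n].
Proof.
apply/seteqP; split => // x _.
exists (Num.truncn (\sum_(i < n) `|tnth x i|)).+1 => // i.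
rewrite !tnth_nseq -ler_norml; apply: le_trans (ltW (truncnS_gt _)).
by rewrite (bigD1 i)//= lerDl sumr_ge0.
Qed.

Lemma measurable_vecE n : @measurable _ (vec R n) =
  <<s range (fun ab : vec R n * vec R n => box ab.1 ab.2) >>.
Proof.
set G := range _; apply/seteqP; split; last first.
  apply: smallest_sub; first exact: sigma_algebra_measurable.
  by move=> _ [ab _ <-]; exact: measurable_box.
suff mid : measurable_fun setT (idfun : g_sigma_algebraType G -> vec R n).
  by move=> A mA; have := mid measurableT A mA; rewrite setTI.
apply/measurable_fun_tnthP => i.
apply: (measurability _ (RGenCInfty.measurableE R)) => // _ [_ [a ->] <-].
rewrite setTI /=.
(* The coordinate half-space x_i >= a is exhausted by boxes whose lower side is a in direction i and
   -k elsewhere. *)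
rewrite (_ : _ @^-1` _ = \bigcup_k
  box [tuple if j == i then a else - k%:R | j < n] (nseq_tuple n k%:R)).
  apply: bigcupT_measurable => k; apply: sub_sigma_algebra.
  by exists ([tuple if j == i then a else - k%:R | j < n], nseq_tuple n k%:R).
apply/seteqP; split => x /=; rewrite in_itv/= andbT.
  move=> ax; have [k _ xk] : (\bigcup_k
    box (nseq_tuple n (- k%:R)) (nseq_tuple n k%:R)) x by rewrite bigcup_box.
  exists k => // j; have := xk j; rewrite !tnth_nseq tnth_mktuple.
  by case: eqP => [->|//] /andP[_ ->]; rewrite ax.
by move=> [k _ /(_ i)]; rewrite tnth_mktuple eqxx => /andP[].
Qed.

Lemma lebesgue_unique n (leb : {measure set (vec R n) -> \bar R}) :
  is_lebesgue leb -> forall A, measurable A -> leb A = lebn n A.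
Proof.
move=> leb_box; apply: (measure_unique
  (range (fun ab : vec R n * vec R n => box ab.1 ab.2))
  (fun k => box (nseq_tuple n (- k%:R)) (nseq_tuple n k%:R))).
- exact: measurable_vecE.
- exact: box_setI_closed.
- by move=> k; exists (nseq_tuple n (- k%:R), nseq_tuple n k%:R).
- exact: bigcup_box.
- move=> _ [[a b] _ <-] /=.
  have [ab|/existsNP[i /negP]] := pselect (forall i, tnth a i <= tnth b i).
    by rewrite leb_box// lebn_box.
  (* [is_lebesgue] constrains only boxes with ordered corners; the others are empty. *)
  rewrite -ltNge => ba; rewrite (_ : box a b = set0) ?measure0//.
  apply/seteqP; split => // x /(_ i) /andP[ax xb].
  by have := le_lt_trans (le_trans ax xb) ba; rewrite ltxx.
- move=> k; rewrite leb_box ?ltry// => i; rewrite !tnth_nseq.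
  by rewrite (@le_trans _ _ 0)// ?oppr_le0 ler0n.
Qed.

Lemma integral_lebesgue n (leb : {measure set (vec R n) -> \bar R})
    (D : set (vec R n)) (f : vec R n -> \bar R) : is_lebesgue leb ->
  (\int[leb]_(x in D) f x = \int[lebn n]_(x in D) f x)%E.
Proof.
by move=> lebE; apply: eq_measure_integral => A mA _; exact: lebesgue_unique.
Qed.

End lebesgue_unique.

(** * Affine changes of variables *)

Section affine.
Context {R : realType}.
Local Notation mu := (@lebesgue_measure R).

Lemma measurable_affine (c b : R) :
  measurable_fun setT ((fun x => c * x + b) : measurableTypeR R -> measurableTypeR R).
Proof. by apply: measurable_funD => //; exact: measurable_funM. Qed.

Lemma lebesgue_measure_affine (c b : R) (A : set R) : 0 < c -> measurable A ->
  mu A = (c%:E * mu ((fun x => c * x + b)%R @^-1` A))%E.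
Proof.
move=> c0 mA; pose h : measurableTypeR R -> measurableTypeR R :=
  fun x => c * x + b.
pose k : {nonneg R} := NngNum (ltW c0).
pose m := measure_function_pushforward__canonical__measure_function_Measure
    mu (measurable_affine c b).
suff : forall A, measurable A -> mu A = mscale k m A by move=> /(_ _ mA).
apply: lebesgue_measure_unique => _ [[x y] _ <-] /=.
rewrite /mscale/= /pushforward.
rewrite [X in (_ * mu X)%E](_ : _ = `](x - b) / c, (y - b) / c]%classic); last first.
  apply/seteqP; split => z /=; rewrite !in_itv/=;
    by rewrite ltr_pdivrMr// ler_pdivlMr// ltrBlDr lerBrDr (mulrC z).
rewrite !lebesgue_measure_itv/= !lte_fin ltr_pM2r ?invr_gt0//.
rewrite ltrD2r; case: ifP => xy; last by rewrite mule0.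
by rewrite -!EFinB -EFinM -mulrBl opprB addrA subrK mulrCA divff ?gt_eqF// mulr1.
Qed.

Lemma integral_affine (c b : R) (f : R -> \bar R) : 0 < c ->
  measurable_fun setT f -> (forall x, 0 <= f x)%E ->
  (\int[mu]_x f x = c%:E * \int[mu]_x f (c * x + b)%R)%E.
Proof.
move=> c0 mf f0.
pose k : {nonneg R} := NngNum (ltW c0).
pose m := measure_function_pushforward__canonical__measure_function_Measure
    mu (measurable_affine c b).
transitivity (\int[mscale k m]_x f x)%E.
  by apply: eq_measure_integral => A mA _; exact: lebesgue_measure_affine.
rewrite ge0_integral_mscale//; congr (_ * _)%E.
by rewrite ge0_integral_pushforward//; exact: measurable_affine.
Qed.

Definition vscale n (c : R) (b x : vec R n) : vec R n :=
  [tuple c * tnth x i + tnth b i | i < n].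

Lemma measurable_vscale n c (b : vec R n) : measurable_fun setT (vscale c b).
Proof.
apply/measurable_fun_tnthP => i.
rewrite (_ : _ \o _ = fun x : vec R n => c * tnth x i + tnth b i); last first.
  by apply/funext => x /=; rewrite tnth_mktuple.
by apply: measurable_funD => //; apply: measurable_funM => //; exact: measurable_tnth.
Qed.

Lemma vscale_vcons n c (b : vec R n.+1) s z :
  vscale c b (vcons (s, z)) =
  vcons (c * s + thead b, vscale c [tuple of behead b] z).
Proof.
apply/eq_from_tnth => i; rewrite tnth_mktuple.
case: (unliftP ord0 i) => [j ->|->//].
by rewrite [b in LHS](tuple_eta b) !tnthS tnth_mktuple.
Qed.

(** Used with c = 1 for translation invariance, c = 1/2 for midpoints with a fixed point, and c = K
    for dilating a level set. *)
Lemma integral_vscale n (c : R) (b : vec R n) (f : vec R n -> \bar R) : 0 < c ->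
  measurable_fun setT f -> (forall x, 0 <= f x)%E ->
  (\int[lebn n]_x f x = (c ^+ n)%:E * \int[lebn n]_x f (vscale c b x))%E.
Proof.
move=> c0; elim: n b f => [|n ih] b f mf f0.
  rewrite !integral_lebn0//; last first.
    by apply: measurableT_comp => //; exact: measurable_vscale.
  by rewrite mul1e; congr f; apply/eq_from_tnth => -[].
rewrite !integral_lebnS//; last first.
  by apply: measurableT_comp => //; exact: measurable_vscale.
pose g s := (\int[lebn n]_z f (vcons (s, z)))%E.
have mg : measurable_fun setT g by exact: measurable_integral_snd.
have g0 s : (0 <= g s)%E by apply: integral_ge0 => z _; exact: f0.
rewrite [LHS](@integral_affine c (thead b) g)//.
rewrite exprS EFinM -muleA; congr (_ * _)%E.
have mfw : measurable_fun setT (fun x => f (vscale c b x)).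
  by apply: measurableT_comp => //; exact: measurable_vscale.
rewrite -ge0_integralZl//; last 3 first.
- exact: (measurable_integral_snd (f := fun x => f (vscale c b x))).
- by move=> s _; apply: integral_ge0 => z _; exact: f0.
- by rewrite lee_fin exprn_ge0// ltW.
apply: eq_integral => s _.
rewrite /g (ih [tuple of behead b])//; last exact: measurable_section_snd.
by congr (_ * _)%E; apply: eq_integral => z _; rewrite vscale_vcons.
Qed.

End affine.

(** * Brunn-Minkowski and Prekopa-Leindler *)

Section brunn_minkowski.
Context {R : realType}.
Local Notation mu := (@lebesgue_measure R).
Implicit Types (A B C : set R) (l : R).

Let split_at (C : set R) z : measurable C ->
  mu C = (mu (C `&` `]-oo, z]) + mu (C `&` `]z, +oo[))%E.
Proof.
move=> mC; rewrite (measureDI mu mC (measurable_itv `]-oo, z])) addeC.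
by congr (_ + mu _)%E; rewrite setDE setCitvl.
Qed.

Let bm_split A B C l a b : 0 < l < 1 ->
  measurable A -> measurable B -> measurable C ->
  (forall x y, A x -> B y -> C (l * x + (1 - l) * y)) ->
  A a -> B b ->
  (l%:E * mu (A `&` `]-oo, a]) + (1 - l)%:E * mu (B `&` `]b, +oo[) <= mu C)%E.
Proof.
move=> /andP[l0 l1] mA mB mC ABC Aa Bb.
have l10 : 0 < 1 - l by rewrite subr_gt0.
rewrite (split_at (l * a + (1 - l) * b) mC); apply: leeD.
- rewrite [leRHS](lebesgue_measure_affine ((1 - l) * b) l0); last exact: measurableI.
  rewrite lee_pmul2l//; apply: le_measure; rewrite ?inE.
  + exact: measurableI.
  + rewrite -[X in measurable X]setTI; apply: measurable_affine => //.
    exact: measurableI.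
  + move=> x [Ax]; rewrite /= !in_itv/= => xa; split; first exact: ABC.
    by rewrite lerD2r ler_pM2l.
- rewrite [leRHS](lebesgue_measure_affine (l * a) l10); last exact: measurableI.
  rewrite lee_pmul2l//; apply: le_measure; rewrite ?inE.
  + exact: measurableI.
  + rewrite -[X in measurable X]setTI; apply: measurable_affine => //.
    exact: measurableI.
  + move=> y [By]; rewrite /= !in_itv/= !andbT => yb.
    rewrite addrC; split; first exact: ABC.
    by rewrite ltrD2l ltr_pM2l.
Qed.

(** If A has a point beyond N, nothing is lost by cutting there. Otherwise A is bounded above, and a
    point within e of the supremum loses at most the interval from it to the supremum. The
    truncation at N covers unbounded A. *)
Let left_part A (N e : R) : measurable A -> A !=set0 -> 0 < e ->
  exists2 a, A a & (mu (A `&` `]-oo, N]) <= mu (A `&` `]-oo, a]) + e%:E)%E.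
Proof.
move=> mA [a0 Aa0] e0.
have [[a [Aa Na]]|] := pselect (exists a, A a /\ N <= a).
  exists a => //; apply: le_trans (leeDl _ _); last by rewrite lee_fin ltW.
  apply: le_measure; rewrite ?inE; [exact: measurableI|exact: measurableI|].
  move=> x [Ax]; rewrite /= !in_itv/= => xN; split => //.
  exact: le_trans xN Na.
move=> /forallNP AN.
have Aub x : A x -> x <= N.
  by move=> Ax; rewrite leNgt; apply/negP => /ltW Nx; exact: (AN x).
have hsA : has_sup A by split; [exists a0|exists N].
have [a Aa supa] := sup_adherent e0 hsA.
exists a => //.
apply: (@le_trans _ _ (mu ((A `&` `]-oo, a]) `|` `]a, sup A]))).
  apply: le_measure; rewrite ?inE; first exact: measurableI.
    by apply: measurableU => //; exact: measurableI.
  move=> x [Ax _]; have [xa|ax] := leP x a.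
    by left; split => //=; rewrite in_itv.
  by right; rewrite /= in_itv/= ax; exact: ub_le_sup hsA.2 _ Ax.
apply: (@le_trans _ _ (mu (A `&` `]-oo, a]) + mu `]a, sup A])%E).
  by apply: measureU2 => //; exact: measurableI.
rewrite leeD2l// lebesgue_measure_itv/=; case: ifP => _.
  by rewrite -EFinB lee_fin lerBlDr addrC -lerBlDr ltW.
by rewrite lee_fin ltW.
Qed.

(** [left_part] for the reflected set; the half-line on the right is open, and the missing endpoint
    is null. *)
Let right_part A (N e : R) : measurable A -> A !=set0 -> 0 < e ->
  exists2 a, A a &
    (mu (A `&` `[(- N)%R, +oo[) <= mu (A `&` `]a, +oo[) + e%:E)%E.
Proof.
move=> mA [a0 Aa0] e0.
have mopp : measurable_fun setT (-%R : measurableTypeR R -> measurableTypeR R).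
  exact: oppr_measurable.
have mNA : measurable (-%R @^-1` A : set (measurableTypeR R)).
  by rewrite -[X in measurable X]setTI; exact: mopp.
have [|a Na H] := @left_part _ N e mNA _ e0.
  by exists (- a0); rewrite /= opprK.
exists (- a) => //.
have muN (B : set R) : measurable B -> mu (-%R @^-1` B) = mu B.
  exact: lebesgue_measureN.
rewrite -muN; last exact: measurableI.
rewrite (_ : _ @^-1` _ = (-%R @^-1` A) `&` `]-oo, N]); last first.
  by apply/seteqP; split => x /=; rewrite !in_itv/= andbT lerN2.
apply: le_trans H _; rewrite leeD2r// -muN; last exact: measurableI.
rewrite (_ : _ @^-1` _ = A `&` `[(- a)%R, +oo[); last first.
  by apply/seteqP; split => x /=; rewrite !in_itv/= andbT opprK lerNl.
apply: (@le_trans _ _ (mu (A `&` `]- a, +oo[ `|` [set (- a)%R]))).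
  apply: le_measure; rewrite ?inE; first exact: measurableI.
    by apply: measurableU => //; exact: measurableI.
  move=> x [Ax]; rewrite /= !in_itv/= !andbT le_eqVlt => /predU1P[->|];
    by [right|left].
rewrite -[leRHS]adde0 -(lebesgue_measure_set1 (- a)).
by apply: measureU2 => //; exact: measurableI.
Qed.

(* The pieces l A + (1-l) b left of l a + (1-l) b and l a + (1-l) B right of it
   are disjoint parts of C; a near sup A and b near inf B. *)
Lemma brunn_minkowski1 A B C l : 0 < l < 1 ->
  measurable A -> measurable B -> measurable C -> A !=set0 -> B !=set0 ->
  (forall x y, A x -> B y -> C (l * x + (1 - l) * y)) ->
  (l%:E * mu A + (1 - l)%:E * mu B <= mu C)%E.
Proof.
move=> /[dup] l01 /andP[l0 l1] mA mB mC A0 B0 ABC.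
have l10 : 0 < 1 - l by rewrite subr_gt0.
have step (k : nat) : (l%:E * mu (A `&` `]-oo, k%:R]) +
    (1 - l)%:E * mu (B `&` `[(- k%:R)%R, +oo[) <= mu C)%E.
  apply/lee_addgt0Pr => e e0.
  have [a Aa Ha] := left_part k%:R mA A0 e0.
  have [b Bb Hb] := right_part k%:R mB B0 e0.
  (* The errors of the two pieces carry the weights l and 1 - l, so together they cost exactly e. *)
  apply: le_trans (leeD2r _ (bm_split l01 mA mB mC ABC Aa Bb)).
  rewrite (_ : e%:E = l%:E * e%:E + (1 - l)%:E * e%:E)%E; last first.
    by rewrite -!EFinM -EFinD -mulrDl addrC subrK mul1r.
  have e0' : (0 <= e%:E)%E by rewrite lee_fin ltW.
  by rewrite addeACA -!ge0_muleDr// leeD// lee_pmul2l.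
have cvg_trunc (D : set (measurableTypeR R)) (F : (set (measurableTypeR R))^nat) : measurable D ->
    (forall k, measurable (F k)) -> {homo F : i j / (i <= j)%N >-> (i <= j)%O} ->
    \bigcup_k F k = setT -> mu (D `&` F k) @[k --> \oo] --> mu D.
  move=> mD mF ndF FT; rewrite -[X in _ --> mu X](setIT D) -FT setI_bigcupr.
  apply: nondecreasing_cvg_mu.
  - by move=> k; exact: measurableI.
  - by apply: bigcupT_measurable => k; exact: measurableI.
  - by move=> i j /ndF/subsetPset ij; apply/subsetPset; exact: setIS.
have cvA : mu (A `&` `]-oo, k%:R]) @[k --> \oo] --> mu A.
  apply: cvg_trunc => //.
    move=> i j ij; apply/subsetPset => x /=; rewrite !in_itv/= => xi.
    by rewrite (le_trans xi)// ler_nat.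
  apply/seteqP; split => // x _; exists (Num.truncn x).+1 => //=.
  by rewrite in_itv/= ltW// truncnS_gt.
have cvB : mu (B `&` `[(- k%:R)%R, +oo[) @[k --> \oo] --> mu B.
  apply: cvg_trunc => //.
    move=> i j ij; apply/subsetPset => x /=; rewrite !in_itv/= !andbT.
    by apply: le_trans; rewrite lerN2 ler_nat.
  apply/seteqP; split => // x _; exists (Num.truncn (- x)).+1 => //=.
  by rewrite in_itv/= andbT lerNl ltW// truncnS_gt.
have cvAB : ((l%:E * mu (A `&` `]-oo, k%:R]) +
    (1 - l)%:E * mu (B `&` `[(- k%:R)%R, +oo[)) @[k --> \oo] -->
    l%:E * mu A + (1 - l)%:E * mu B)%E.
  apply: cvgeD; [|exact: cvgeZl cvA|exact: cvgeZl cvB].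
  by apply: ge0_adde_def; rewrite inE mule_ge0// lee_fin ltW.
rewrite -(cvg_lim _ cvAB)//; apply: lime_le; last exact: nearW.
by apply/cvg_ex; eexists; exact: cvAB.
Qed.

End brunn_minkowski.

Section layer_cake.
Context {R : realType}.
Local Notation mu := (@lebesgue_measure R).

Lemma measurable_hypograph d (T : measurableType d) (f : T -> \bar R) :
  measurable_fun setT f ->
  measurable [set p : T * measurableTypeR R | ((p.2 : R)%:E < f p.1)%E].
Proof.
move=> mf.
rewrite (_ : mkset _ =
    setT `&` [set p : T * measurableTypeR R | (0 < f p.1 - (p.2 : R)%:E)%E]).
  apply: emeasurable_fun_o_infty => //; apply: emeasurable_funB.
    exact: measurableT_comp.
  by apply/measurable_EFinP.
rewrite setTI; apply/seteqP; split => p;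
  by have /= -> := sube_gt0 (p.2 : R)%:E (f p.1).
Qed.

Lemma measurable_superlevel d (T : measurableType d)
    (m : {sigma_finite_measure set T -> \bar R}) (f : T -> \bar R) :
  measurable_fun setT f ->
  measurable_fun setT
    (fun s : measurableTypeR R => m [set x | (s : R)%:E < f x])%E.
Proof.
move=> /measurable_hypograph mE.
have := measurable_fun_ysection m mE.
apply: eq_measurable_fun => s _; congr (m _).
by apply/seteqP; split => x; rewrite /ysection/= inE.
Qed.

Lemma layer_cake d (T : measurableType d)
    (m : {sigma_finite_measure set T -> \bar R}) (f : T -> \bar R) :
  measurable_fun setT f -> (forall x, 0 <= f x)%E ->
  (\int[m]_x f x = \int[mu]_(s in `]0%R, +oo[) m [set x | s%:E < f x])%E.
Proof.
move=> mf f0; pose E := [set p : T * measurableTypeR R | 0 < p.2 /\ (p.2%:E < f p.1)%E].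
have mE : measurable E.
  rewrite (_ : E = [set p | 0 < p.2] `&` [set p | (p.2%:E < f p.1)%E])//.
  apply: measurableI.
    rewrite (_ : mkset _ = snd @^-1` `]0, +oo[%classic); last first.
      by apply/seteqP; split => p /=; rewrite in_itv/= andbT.
    by rewrite -[X in measurable X]setTI; exact: measurable_snd.
  exact: measurable_hypograph.
transitivity (\int[m]_x \int[mu]_s (\1_E (x, s))%:E)%E.
  apply: eq_integral => x _.
  rewrite (_ : (fun s => _) = fun s => (\1_[set s | 0 < s /\ (s%:E < f x)%E] s)%:E)//.
  rewrite integral_indic//= ?setIT; last first.
    rewrite (_ : mkset _ = xsection E x); last first.
      by apply/seteqP; split => s; rewrite /xsection/= inE.
    exact: measurable_xsection.
  case fx : (f x) (f0 x) => [r| |] // r0.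
    rewrite (_ : mkset _ = `]0, r[%classic); last first.
      by apply/seteqP; split => s /=; rewrite in_itv/= lte_fin => /andP.
    by rewrite lebesgue_measure_itv/= lte_fin; move: r0; rewrite lee_fin le_eqVlt => /predU1P[<-|->]; rewrite ?ltxx// sube0.
  rewrite (_ : mkset _ = `]0, +oo[%classic); last first.
    by apply/seteqP; split => s /=; rewrite in_itv/= andbT; [case|rewrite ltry].
  by rewrite lebesgue_measure_itv/= ltry.
rewrite (fubini_tonelli (fun p => (\1_E p)%:E))//; last first.
  by apply/measurable_EFinP; exact: measurable_indic.
rewrite [RHS]integral_mkcond; apply: eq_integral => s _.
rewrite patchE; case: ifPn => s0.
  rewrite inE/= in_itv/= andbT in s0.
  rewrite (_ : (fun x => _) = fun x => (\1_[set x | (s%:E < f x)%E] x)%:E).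
    rewrite integral_indic//= ?setIT//.
    by rewrite -[X in measurable X]setTI; exact: emeasurable_fun_o_infty.
  apply/funext => x; rewrite /E !indicE; congr (_%:R%:E); congr nat_of_bool.
  by apply/idP/idP; rewrite !inE => // -[].
apply: integral0_eq => x _; rewrite indicE memNset// => -[/= s0'].
by move: s0; rewrite notin_setE/= in_itv/= s0'.
Qed.

End layer_cake.

Section prekopa_leindler.
Context {R : realType}.
Local Notation mu := (@lebesgue_measure R).
Implicit Types (l : R).

(* "P^l Q^(1-l) <= S" in [0, +oo], phrased with levels so that neither powers
   nor products of infinite values occur. *)
Definition geom_le l (P Q S : \bar R) : Prop := forall a b : R,
  ((expR a)%:E < P -> (expR b)%:E < Q ->
   (expR (l * a + (1 - l) * b))%:E < S)%E.

(** For 0 < s < 1 the sets f > s and g > s are nonempty and their combination lies in h > s.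
    One-dimensional Brunn-Minkowski at each level, integrated over s by layer cake, gives the bound.
    Normalizing both suprema to 1 keeps both level sets nonempty on the same range of s. *)
Let pl_normalized l (f g h : R -> \bar R) : 0 < l < 1 ->
  measurable_fun setT f -> measurable_fun setT g -> measurable_fun setT h ->
  (forall x, 0 <= f x <= 1)%E -> (forall x, 0 <= g x <= 1)%E ->
  (forall x, 0 <= h x)%E ->
  (forall s : R, s < 1 -> exists x, (s%:E < f x)%E) ->
  (forall s : R, s < 1 -> exists x, (s%:E < g x)%E) ->
  (forall s x y : R, 0 < s -> (s%:E < f x)%E -> (s%:E < g y)%E ->
     (s%:E < h (l * x + (1 - l) * y)%R)%E) ->
  (l%:E * \int[mu]_x f x + (1 - l)%:E * \int[mu]_x g x <= \int[mu]_x h x)%E.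
Proof.
move=> l01 mf mg mh f01 g01 h0 supf supg fgh.
have lset (k : R -> \bar R) s : measurable_fun setT k ->
    measurable [set x : measurableTypeR R | (s%:E < k x)%E].
  by move=> mk; rewrite -[X in measurable X]setTI; exact: emeasurable_fun_o_infty.
have f0 x : (0 <= f x)%E by case/andP: (f01 x).
have g0 x : (0 <= g x)%E by case/andP: (g01 x).
have mS (k : R -> \bar R) (D : set (measurableTypeR R)) : measurable D ->
    measurable_fun setT k ->
    measurable_fun D (fun s : measurableTypeR R => mu [set x | (s%:E < k x)%E]).
  move=> mD mk; apply: (measurable_funS measurableT) => //.
  exact: measurable_superlevel.
have lc1 (k : R -> \bar R) : measurable_fun setT k -> (forall x, 0 <= k x <= 1)%E ->
    (\int[mu]_x k x = \int[mu]_(s in `]0%R, 1%R[) mu [set x | s%:E < k x])%E.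
  move=> mk k01; rewrite layer_cake//; last by move=> x; case/andP: (k01 x).
  rewrite integral_mkcond [RHS]integral_mkcond; apply: eq_integral => s _.
  rewrite !patchE !mem_setE !in_itv/= andbT; case: ltP => //= s0.
  case: ltP => // s1; rewrite (_ : mkset _ = set0) ?measure0//.
  apply/seteqP; split => // x /=; apply/negP; rewrite -leNgt.
  by case/andP: (k01 x) => _ /le_trans; apply; rewrite lee_fin.
have [l0 l1] := andP l01.
have l0' : (0 <= l%:E)%E by rewrite lee_fin ltW.
have l1' : (0 <= (1 - l)%:E)%E by rewrite lee_fin subr_ge0 ltW.
rewrite (lc1 f)// (lc1 g)// layer_cake//.
rewrite -!ge0_integralZl//; try exact: mS.
rewrite -ge0_integralD//; last 4 first.
- by move=> s _; rewrite mule_ge0.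
- by apply: measurable_funeM; exact: mS.
- by move=> s _; rewrite mule_ge0.
- by apply: measurable_funeM; exact: mS.
apply: (@le_trans _ _ (\int[mu]_(s in `]0%R, 1%R[) mu [set x | s%:E < h x])%E).
  apply: ge0_le_integral => //.
  - by move=> s _; rewrite adde_ge0// mule_ge0.
  - by apply: emeasurable_funD; apply: measurable_funeM; exact: mS.
  - exact: mS.
  - move=> s /=; rewrite in_itv/= => /andP[s0 s1].
    apply: brunn_minkowski1; rewrite //; try exact: lset.
    + exact: supf.
    + exact: supg.
    + by move=> x y; exact: fgh.
apply: ge0_subset_integral => //; first exact: mS.
by move=> s /=; rewrite !in_itv/= andbT => /andP[].
Qed.


(** Weighted arithmetic-geometric mean inequality in exponential form: both exponentials are
    compared with the tangent of exp at the mean exponent m. *)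
Lemma expR_geom_mean l (u v : R) : 0 <= l <= 1 ->
  expR (l * u + (1 - l) * v) <= l * expR u + (1 - l) * expR v.
Proof.
move=> /andP[l0 l1]; set m := _ + _ * v.
have tangent w : expR m * (1 + (w - m)) <= expR w.
  rewrite -[leRHS](_ : expR m * expR (w - m) = _); last by rewrite -expRD subrKC.
  by rewrite ler_pM2l ?expR_gt0// expR_ge1Dx.
have Hu : l * (expR m * (1 + (u - m))) <= l * expR u by exact: ler_wpM2l.
have Hv : (1 - l) * (expR m * (1 + (v - m))) <= (1 - l) * expR v.
  by rewrite ler_wpM2l// subr_ge0.
suff -> : expR m = l * (expR m * (1 + (u - m))) +
    (1 - l) * (expR m * (1 + (v - m))) by exact: lerD.
by rewrite /m; ring.
Qed.

(** Divide f and g by their suprema e^A and e^B, and h by e^(l A + (1-l) B). The normalized case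
    bounds the arithmetic mean of the integrals, which dominates their geometric mean. Boundedness
    makes the suprema finite; positive integrals make them positive. *)
Let pl_bounded l (f g h : R -> \bar R) (N : R) : 0 < l < 1 ->
  measurable_fun setT f -> measurable_fun setT g -> measurable_fun setT h ->
  (forall x, 0 <= f x <= N%:E)%E -> (forall x, 0 <= g x <= N%:E)%E ->
  (forall x, 0 <= h x)%E ->
  (forall x y, geom_le l (f x) (g y) (h (l * x + (1 - l) * y))) ->
  geom_le l (\int[mu]_x f x) (\int[mu]_x g x) (\int[mu]_x h x).
Proof.
move=> l01 mf mg mh f0N g0N h0 fgh a b fa gb.
have [l0 l1] := andP l01; have l1' : 0 < 1 - l by rewrite subr_gt0.
have sup_pos (k : R -> \bar R) c : (forall x, 0 <= k x <= N%:E)%E ->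
    ((expR c)%:E < \int[mu]_x k x)%E ->
    exists A, (forall x, k x <= (expR A)%:E)%E /\
      (forall s, s < 1 -> exists x, ((s * expR A)%:E < k x)%E).
  move=> k0N kc; pose S := ereal_sup (range k).
  have kS x : (k x <= S)%E by apply: ereal_sup_ubound; exists x.
  have SN : (S <= N%:E)%E.
    by apply: ge_ereal_sup => _ [x _ <-]; case/andP: (k0N x).
  have S0 : (0 < S)%E.
    rewrite ltNge; apply/negP => S0; move: kc; rewrite integral0_eq.
      by rewrite ltNge lee_fin expR_ge0.
    move=> x _; apply/eqP; rewrite eq_le (le_trans (kS x) S0)/=.
    by case/andP: (k0N x).
  have [S' SE] : exists S', S = S'%:E.
    by case: (S) S0 SN => // r _ _; exists r.
  rewrite SE lte_fin in S0.
  exists (ln S'); rewrite lnK ?posrE//; split; first by move=> x; rewrite -SE.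
  move=> s s1.
  have : ((s * S')%:E < S)%E by rewrite SE lte_fin gtr_pMl.
  by move=> /ereal_sup_gt[_ [x _ <-] ?]; exists x.
have [A [fA Asup]] := sup_pos f a f0N fa.
have [B [gB Bsup]] := sup_pos g b g0N gb.
pose m := l * A + (1 - l) * B.
have scaled (k : R -> \bar R) c : measurable_fun setT k -> (forall x, 0 <= k x)%E ->
    (\int[mu]_x (k x * (expR (- c))%:E) = \int[mu]_x k x * (expR (- c))%:E)%E.
  by move=> mk k0; rewrite ge0_integralZr// lee_fin expR_ge0.
have f0 x : (0 <= f x)%E by case/andP: (f0N x).
have g0 x : (0 <= g x)%E by case/andP: (g0N x).
have mZ (k : R -> \bar R) c : measurable_fun setT k ->
    measurable_fun setT (fun x => (k x * (expR (- c))%:E)%E).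
  by move=> mk; apply: emeasurable_funM.
have ge0Z (k : R -> \bar R) c x : (0 <= k x)%E -> (0 <= k x * (expR (- c))%:E)%E.
  by move=> k0; rewrite mule_ge0// lee_fin expR_ge0.
have ltZ (x : \bar R) c s : (s%:E < x * (expR (- c))%:E)%E = ((s * expR c)%:E < x)%E.
  by rewrite expRN lte_pdivlMr ?expR_gt0// EFinM.
have K := @pl_normalized l (fun x => f x * (expR (- A))%:E)%E
  (fun x => g x * (expR (- B))%:E)%E (fun x => h x * (expR (- m))%:E)%E l01
  (mZ _ _ mf) (mZ _ _ mg) (mZ _ _ mh).
rewrite !scaled// in K.
have leZ (k : R -> \bar R) c : (forall x, 0 <= k x)%E ->
    (forall x, k x <= (expR c)%:E)%E ->
    forall x, (0 <= k x * (expR (- c))%:E <= 1)%E.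
  move=> k0 kc x; rewrite ge0Z//= leNgt ltZ mul1r -leNgt.
  exact: kc.
have {}K := K (leZ _ _ f0 fA) (leZ _ _ g0 gB) (fun x => ge0Z h m x (h0 x)).
have {K} H : (l%:E * (\int[mu]_x f x * (expR (- A))%:E) +
    (1 - l)%:E * (\int[mu]_x g x * (expR (- B))%:E) <=
    \int[mu]_x h x * (expR (- m))%:E)%E.
  apply: K.
  - by move=> s /Asup[x fx]; exists x; rewrite ltZ.
  - by move=> s /Bsup[x gx]; exists x; rewrite ltZ.
  - move=> s x y s0; rewrite !ltZ => sf sg.
    have := fgh x y (ln s + A) (ln s + B).
    rewrite !expRD !lnK ?posrE// => /(_ sf sg).
    rewrite -[s in X in _ -> X]lnK ?posrE// -!expRD.
    by rewrite (_ : l * (ln s + A) + _ = ln s + m)// /m; ring.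
have H1 : ((expR (l * (a - A) + (1 - l) * (b - B)))%:E <
    \int[mu]_x h x * (expR (- m))%:E)%E.
  apply: lt_le_trans H; apply: (@le_lt_trans _ _
    (l%:E * (expR (a - A))%:E + (1 - l)%:E * (expR (b - B))%:E)%E).
    by rewrite -!EFinM -EFinD lee_fin expR_geom_mean// !ltW.
  apply: lte_leD => //.
  + by rewrite !expRD EFinM lte_pmul2l// lte_pmul2r ?lte_fin ?expR_gt0.
  + by rewrite lee_pmul2l// !expRD EFinM lee_pmul2r ?lte_fin ?expR_gt0// ltW.
move: H1; rewrite ltZ -expRD.
by rewrite (_ : _ + _ + m = l * a + (1 - l) * b)// /m; ring.
Qed.

Lemma prekopa_leindler1 l (f g h : R -> \bar R) : 0 < l < 1 ->
  measurable_fun setT f -> measurable_fun setT g -> measurable_fun setT h ->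
  (forall x, 0 <= f x)%E -> (forall x, 0 <= g x)%E -> (forall x, 0 <= h x)%E ->
  (forall x y, geom_le l (f x) (g y) (h (l * x + (1 - l) * y))) ->
  geom_le l (\int[mu]_x f x) (\int[mu]_x g x) (\int[mu]_x h x).
Proof.
move=> l01 mf mg mh f0 g0 h0 fgh a b fa gb.
(* Truncating f and g from above preserves the hypothesis with the same h. By monotone convergence,
   a strict lower bound on an integral already holds for all high enough truncations, so one height
   serves both functions. *)
have trunc (k : R -> \bar R) (c : \bar R) : measurable_fun setT k ->
    (forall x, 0 <= k x)%E -> (c < \int[mu]_x k x)%E ->
    exists n : nat, forall p : nat, (n <= p)%N ->
      (c < \int[mu]_x mine (k x) p%:R%:E)%E.
  move=> mk k0 ck; pose kn (n : nat) x := mine (k x) n%:R%:E.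
  have ndk x : {homo kn ^~ x : i j / (i <= j)%N >-> (i <= j)%E}.
    move=> i j ij; rewrite /kn le_min ge_min lexx/= ge_min lee_fin ler_nat ij.
    by rewrite orbT.
  have mkn n : measurable_fun setT (kn n) by exact: measurable_mine.
  have kn0 n x : (0 <= kn n x)%E by rewrite /kn le_min k0/= lee_fin.
  have kE : (\int[mu]_x k x = \int[mu]_x limn (kn ^~ x))%E.
    apply: eq_integral => x _; apply/esym/cvg_lim => //.
    have [kx|[r r0 kx]] := (gee0P _).1 (k0 x).
      rewrite kx (_ : kn ^~ x = fun n => n%:R%:E); first exact/cvgenyP.
      by apply/funext => n; rewrite /kn kx min_r// leey.
    apply: cvg_near_cst; near=> n; rewrite /kn kx min_l// lee_fin.
    by near: n; exact: nbhs_infty_ger.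
  have ndI : {homo (fun n => \int[mu]_x kn n x)%E : i j / (i <= j)%N >-> (i <= j)%E}.
    move=> i j ij; apply: ge0_le_integral; [by []|by move=> x _; exact: kn0
      |exact: mkn|exact: mkn|by move=> x _; exact: ndk].
  have := @cvg_monotone_convergence _ _ _ mu _ measurableT kn mkn
    (fun n x _ => kn0 n x) (fun x _ => ndk x).
  rewrite -kE => /cvg_lim => /(_ (@ereal_hausdorff _)).
  rewrite (cvg_lim _ (ereal_nondecreasing_cvgn ndI))// => supE.
  rewrite -supE in ck; have [_ [n _ <-] cn] := ereal_sup_gt ck.
  by exists n => p np; exact: lt_le_trans cn (ndI _ _ np).
have [n fn] := trunc _ _ mf f0 fa; have [p gp] := trunc _ _ mg g0 gb.
have := @pl_bounded l (fun x => mine (f x) (maxn n p)%:R%:E)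
  (fun x => mine (g x) (maxn n p)%:R%:E) h (maxn n p)%:R l01.
apply => //.
- exact: measurable_mine.
- exact: measurable_mine.
- by move=> x; rewrite le_min f0 lee_fin ler0n/= ge_min lexx orbT.
- by move=> x; rewrite le_min g0 lee_fin ler0n/= ge_min lexx orbT.
- by move=> x y c d; rewrite !lt_min => /andP[+ _] /andP[+ _]; exact: fgh.
- by apply: fn; exact: leq_maxl.
- by apply: gp; exact: leq_maxr.
Unshelve. all: by end_near. Qed.

(** Fubini induction: by the induction hypothesis the sections' integrals, as functions of the head,
    satisfy the hypothesis of the one-dimensional case. *)
Lemma prekopa_leindler n l (f g h : vec R n -> \bar R) : 0 < l < 1 ->
  measurable_fun setT f -> measurable_fun setT g -> measurable_fun setT h ->
  (forall x, 0 <= f x)%E -> (forall x, 0 <= g x)%E -> (forall x, 0 <= h x)%E ->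
  (forall x y, geom_le l (f x) (g y) (h (comb l x y))) ->
  geom_le l (\int[lebn n]_x f x) (\int[lebn n]_x g x) (\int[lebn n]_x h x).
Proof.
move=> l01; elim: n f g h => [|n ih] f g h mf mg mh f0 g0 h0 fgh.
  rewrite !integral_lebn0//.
  have := fgh [tuple] [tuple]; congr geom_le; congr h.
  by apply/eq_from_tnth => -[].
rewrite !integral_lebnS//; apply: prekopa_leindler1 => //.
- exact: measurable_integral_snd.
- exact: measurable_integral_snd.
- exact: measurable_integral_snd.
- by move=> s; apply: integral_ge0.
- by move=> s; apply: integral_ge0.
- by move=> s; apply: integral_ge0.
- move=> s t; apply: ih => //; try exact: measurable_section_snd.
  move=> z w; have := fgh (vcons (s, z)) (vcons (t, w)).
  by rewrite comb_vcons.
Qed.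

End prekopa_leindler.

(** * Log-concave densities and their convolution powers *)

Section log_concave.
Context {R : realType}.

Lemma geom_leP (l p q s : R) : 0 < l < 1 ->
  geom_le l p%:E q%:E s%:E <->
  (0 < p -> 0 < q -> expR (l * ln p + (1 - l) * ln q) <= s).
Proof.
move=> /andP[l0 l1]; split => [H p0 q0|H a b]; last first.
  rewrite !lte_fin => ap bq.
  have p0 := lt_trans (expR_gt0 _) ap; have q0 := lt_trans (expR_gt0 _) bq.
  apply: lt_le_trans (H p0 q0); rewrite ltr_expR ltrD//.
    by rewrite ltr_pM2l// -ltr_expR lnK.
  by rewrite ltr_pM2l ?subr_gt0// -ltr_expR lnK.
set m := _ + _; rewrite leNgt; apply/negP => sm.
(* [geom_le] speaks of strictly smaller levels, so the levels are lowered by e; taking e = m - ln s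
   then contradicts s < e^m. *)
have below e : 0 < e -> expR (m - e) < s.
  move=> e0; have := H (ln p - e) (ln q - e).
  rewrite !lte_fin (_ : l * _ + _ = m - e); last by rewrite /m; ring.
  by apply; rewrite expRB lnK// gtr_pMr// invf_lt1 ?expR_gt1 ?expR_gt0.
have s0 : 0 < s by apply: lt_trans (expR_gt0 _) (below 1 ltr01).
have := below (m - ln s); rewrite subr_gt0 subKr lnK ?posrE// ltxx => K.
by suff: false by []; apply: K; rewrite -ltr_expR lnK.
Qed.

Lemma geom_leM (l p q s p' q' s' : R) : 0 < l < 1 ->
  0 <= p -> 0 <= q -> 0 <= p' -> 0 <= q' ->
  geom_le l p%:E q%:E s%:E -> geom_le l p'%:E q'%:E s'%:E ->
  geom_le l (p * p')%:E (q * q')%:E (s * s')%:E.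
Proof.
move=> l01 p0 q0 p0' q0' /geom_leP H /geom_leP H'; apply/geom_leP => //.
have pos (x y : R) : 0 <= x -> 0 <= y -> 0 < x * y -> 0 < x /\ 0 < y.
  move=> x0 y0 xy; rewrite !lt0r x0 y0 !andbT.
  by move: xy; rewrite lt0r mulf_eq0 negb_or => /andP[/andP[-> ->]].
move=> /pos[]// P P' /pos[]// Q Q'.
rewrite !lnM ?posrE//; have := ler_pM (expR_ge0 _) (expR_ge0 _) (H l01 P Q) (H' l01 P' Q').
by apply: le_trans; rewrite -expRD ler_expR le_eqVlt; apply/orP; left; apply/eqP; ring.
Qed.

(** Phrased through [geom_le], so that it feeds Prekopa-Leindler directly and zeros of F need no
    convention. *)
Definition lconcave n (F : vec R n -> R) := forall l x y, 0 < l < 1 ->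
  geom_le l (F x)%:E (F y)%:E (F (comb l x y))%:E.

Lemma log_concave_fun_lconcave n (F : vec R n -> R) :
  log_concave_fun F -> lconcave F.
Proof.
move=> [F0 lcF] l x y l01; apply/geom_leP => // Fx Fy.
by apply: le_trans (lcF x y l l01); rewrite /powR !gt_eqF// expRD.
Qed.

Lemma lconcave_superlevel n (F : vec R n -> R) c : 0 < c -> lconcave F ->
  convex_vset [set x | c <= F x].
Proof.
move=> c0 lcF x y l l01 /= cx cy.
have Fx := lt_le_trans c0 cx; have Fy := lt_le_trans c0 cy.
have /andP[l0 l1] := l01.
have /geom_leP := lcF l x y l01; move=> /(_ l01 Fx Fy); apply: le_trans.
rewrite -[leLHS]lnK ?posrE// ler_expR (_ : ln c = l * ln c + (1 - l) * ln c); last by ring.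
by rewrite lerD// ler_pM2l ?subr_gt0// ler_ln.
Qed.

End log_concave.

Section convolution.
Context {R : realType} {n : nat}.
Local Notation leb := (lebn (R := R) n).
Implicit Types (F : vec R n -> R) (phi : vec R n -> \bar R).

Lemma measurable_vec d (T : measurableType d) (h : T -> vec R n) :
  (forall i, measurable_fun setT (fun x => tnth (h x) i)) ->
  measurable_fun setT h.
Proof. by move=> mh; apply/measurable_fun_tnthP. Qed.

Lemma measurable_tnthT d (T : measurableType d) (h : T -> vec R n) i :
  measurable_fun setT h -> measurable_fun setT (fun x => tnth (h x) i).
Proof. by move=> mh; apply: (measurableT_comp (measurable_tnth i) mh). Qed.

Lemma measurable_vadd d (T : measurableType d) (h k : T -> vec R n) :
  measurable_fun setT h -> measurable_fun setT k ->
  measurable_fun setT (fun x => vadd (h x) (k x)).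
Proof.
move=> mh mk; apply: measurable_vec => i.
under eq_fun do rewrite tnth_mktuple.
by apply: measurable_funD; exact: measurable_tnthT.
Qed.

Lemma measurable_vsub d (T : measurableType d) (h k : T -> vec R n) :
  measurable_fun setT h -> measurable_fun setT k ->
  measurable_fun setT (fun x => vsub (h x) (k x)).
Proof.
move=> mh mk; apply: measurable_vec => i.
under eq_fun do rewrite tnth_mktuple.
by apply: measurable_funB; exact: measurable_tnthT.
Qed.

Lemma integral_vadd phi y : measurable_fun setT phi -> (forall x, 0 <= phi x)%E ->
  (\int[leb]_x phi (vadd x y) = \int[leb]_x phi x)%E.
Proof.
move=> mphi phi0; rewrite [RHS](integral_vscale y ltr01)// expr1n mul1e.
apply: eq_integral => x _; congr phi; apply/eq_from_tnth => i.
by rewrite !tnth_mktuple mul1r.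
Qed.

(** The density of X + Y for X, Y independent with density F; j iterations correspond to 2^j
    copies. *)
Definition conv F (x : vec R n) : R :=
  fine (\int[leb]_y (F (vsub x y) * F y)%:E)%E.

(** The same M bounds all convolution powers, because [conv F] averages translates of F against the
    probability density F. This also makes the integrals in [conv] finite, so [fine] loses
    nothing. *)
Definition lc_density (M : R) F := [/\ (forall x, 0 <= F x <= M),
  measurable_fun setT F, (\int[leb]_x (F x)%:E = 1)%E & lconcave F].

Section conv_theory.
Variables (M : R) (F : vec R n -> R).
Hypothesis FM : lc_density M F.

Let F0 x : 0 <= F x. Proof. by case: FM => /(_ x)/andP[]. Qed.
Let FleM x : F x <= M. Proof. by case: FM => /(_ x)/andP[]. Qed.
Let mF : measurable_fun setT F. Proof. by case: FM. Qed.
Let F1 : (\int[leb]_x (F x)%:E = 1)%E. Proof. by case: FM. Qed.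
Let lcF : lconcave F. Proof. by case: FM. Qed.

Let mFF : measurable_fun setT
  (fun p : vec R n * vec R n => F (vsub p.1 p.2) * F p.2).
Proof.
apply: measurable_funM; last exact: (measurableT_comp mF).
by apply: (measurableT_comp mF); exact: measurable_vsub.
Qed.

Let mFFx x : measurable_fun setT (fun y => F (vsub x y) * F y).
Proof. exact: (measurableT_comp mFF (measurable_pair1 x)). Qed.

Let FF_ge0 x y : (0 <= (F (vsub x y) * F y)%:E)%E.
Proof. by rewrite lee_fin mulr_ge0. Qed.

Let conv_le x : (\int[leb]_y (F (vsub x y) * F y)%:E <= M%:E)%E.
Proof.
apply: (@le_trans _ _ (\int[leb]_y (M%:E * (F y)%:E))%E).
  apply: ge0_le_integral => //.
  - exact/measurable_EFinP.
  - by apply/measurable_EFinP; exact: measurable_funM.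
  - by move=> y _; rewrite -EFinM lee_fin ler_wpM2r.
rewrite ge0_integralZl ?F1 ?mule1//; first exact/measurable_EFinP.
by move=> y _; rewrite lee_fin.
by rewrite lee_fin (le_trans (F0 x)).
Qed.

Lemma convE x : ((conv F x)%:E = \int[leb]_y (F (vsub x y) * F y)%:E)%E.
Proof.
rewrite fineK// ge0_fin_numE ?(le_lt_trans (conv_le x)) ?ltry//.
exact: integral_ge0.
Qed.

Let conv_bounds x : 0 <= conv F x <= M.
Proof.
by rewrite -!lee_fin convE conv_le andbT integral_ge0.
Qed.

Let measurable_conv : measurable_fun setT (conv F).
Proof.
apply/measurable_EFinP; rewrite (_ : _ \o _ =
  fun x => \int[leb]_y (F (vsub x y) * F y)%:E)%E; last exact/funext/convE.
apply: (measurable_fun_fubini_tonelli_F (fun p => (F (vsub p.1 p.2) * F p.2)%:E)).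
  exact/measurable_EFinP.
by move=> p; exact: FF_ge0.
Qed.

(** The expectation of phi(X + Y), by Tonelli and translation. Total mass, half-space mass and
    moments of [conv F] are all read off from it. *)
Lemma integral_conv phi : measurable_fun setT phi -> (forall x, 0 <= phi x)%E ->
  (\int[leb]_x (phi x * (conv F x)%:E) =
   \int[leb]_y ((F y)%:E * \int[leb]_x (phi (vadd x y) * (F x)%:E)))%E.
Proof.
move=> mphi phi0.
transitivity (\int[leb]_x \int[leb]_y (phi x * (F (vsub x y) * F y)%:E))%E.
  apply: eq_integral => x _; rewrite convE ge0_integralZl//.
  by apply/measurable_EFinP; exact: mFFx.
rewrite (fubini_tonelli (fun p => phi p.1 * (F (vsub p.1 p.2) * F p.2)%:E)%E); last 2 first.
- apply: emeasurable_funM; first exact: (measurableT_comp mphi).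
  exact/measurable_EFinP.
- by move=> p; rewrite mule_ge0.
apply: eq_integral => y _.
transitivity (\int[leb]_x ((F y)%:E * (phi x * (F (vsub x y))%:E)))%E.
  by apply: eq_integral => x _; rewrite /= EFinM muleA muleC.
have mphiF : measurable_fun setT (fun x => phi x * (F (vsub x y))%:E)%E.
  apply: emeasurable_funM => //; apply/measurable_EFinP.
  by apply: (measurableT_comp mF); exact: measurable_vsub.
have phiF0 x : (0 <= phi x * (F (vsub x y))%:E)%E by rewrite mule_ge0// lee_fin.
rewrite ge0_integralZl//; last by rewrite lee_fin.
congr (_ * _)%E; rewrite -(integral_vadd y mphiF phiF0).
by apply: eq_integral => x _; rewrite vaddK.
Qed.

(** Log-concavity: the integrand F(x - y) F(y) is log-concave jointly in (x, y), and
    Prekopa-Leindler passes this to its integral over y. *)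
Lemma conv_lc_density : lc_density M (conv F).
Proof.
split => //.
- have := @integral_conv (cst 1%E) (measurable_cst _) (fun _ : vec R n => @lee01 R).
  under eq_integral do rewrite /= mul1e.
  move=> ->; rewrite -[RHS]F1; apply: eq_integral => y _.
  by under eq_integral do rewrite /= mul1e; rewrite F1 mule1.
- move=> l x x' l01; rewrite !convE; apply: prekopa_leindler => //.
  + exact/measurable_EFinP.
  + exact/measurable_EFinP.
  + exact/measurable_EFinP.
  + move=> y y'; rewrite (_ : vsub (comb _ _ _) _ = comb l (vsub x y) (vsub x' y')).
      by apply: geom_leM => //; exact: lcF.
    by apply/eq_from_tnth => i; rewrite !tnth_mktuple; ring.
Qed.

(** If X and Y both lie in the half-space at height t, then X + Y lies in the one at height 2t;
    independence squares the probability. *)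
Lemma conv_halfspace u t p : 0 <= p ->
  (p%:E <= \int[leb]_x ((\1_[set x | (t <= dotp u x)%R] x)%:E * (F x)%:E))%E ->
  ((p ^+ 2)%:E <=
    \int[leb]_x ((\1_[set x | (t + t <= dotp u x)%R] x)%:E * (conv F x)%:E))%E.
Proof.
move=> p0 pF; set H := [set x | t + t <= _]; set G := [set x | t <= _] in pF.
have mG : measurable_fun setT (fun x => (\1_G x)%:E : \bar R).
  by apply/measurable_EFinP; apply: measurable_indic; exact: measurable_halfspace.
have mH : measurable_fun setT (fun x => (\1_H x)%:E : \bar R).
  by apply/measurable_EFinP; apply: measurable_indic; exact: measurable_halfspace.
have mEF : measurable_fun setT (fun x => (F x)%:E) by exact/measurable_EFinP.
rewrite integral_conv//.
apply: (@le_trans _ _ (\int[leb]_y (p%:E * ((\1_G y)%:E * (F y)%:E)))%E).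
  rewrite ge0_integralZl//; last 2 first.
  - exact: emeasurable_funM.
  - by move=> x _; rewrite mule_ge0 ?lee_fin.
  by rewrite expr2 EFinM lee_wpmul2l// lee_fin.
have mvH : measurable_fun setT (fun z : vec R n * vec R n =>
    (\1_H (vadd z.2 z.1))%:E * (F z.2)%:E)%E.
  apply: emeasurable_funM; last exact: (measurableT_comp mEF).
  by apply: (measurableT_comp mH); exact: measurable_vadd.
apply: ge0_le_integral => //.
- by move=> y _; rewrite !mule_ge0 ?lee_fin.
- by apply: measurable_funeM; exact: emeasurable_funM.
- apply: emeasurable_funM => //.
  apply: (measurable_fun_fubini_tonelli_F (fun z : vec R n * vec R n =>
    (\1_H (vadd z.2 z.1))%:E * (F z.2)%:E)%E) => //.
  by move=> z; rewrite mule_ge0 ?lee_fin.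
- move=> y _; rewrite muleA muleC; apply: lee_wpmul2l; first by rewrite lee_fin.
  have [Gy|Gy] := pselect (G y); last first.
    rewrite (_ : \1_G y = 0) ?mule0; last by rewrite indicE memNset.
    rewrite integral_ge0// => x _.
    by rewrite mule_ge0 ?lee_fin.
  rewrite (_ : \1_G y = 1) ?mule1; last by rewrite indicE mem_set.
  apply: le_trans pF _.
  apply: ge0_le_integral => //.
  + by move=> x _; rewrite mule_ge0 ?lee_fin.
  + exact: emeasurable_funM.
  + exact: (measurableT_comp mvH (measurable_pair1 y)).
  + move=> x _; apply: lee_wpmul2r; first by rewrite lee_fin.
    rewrite lee_fin !indicE ler_nat; apply: leq_trans (_ : (x \in G <= (vadd x y \in H))%N) _ => //.
    case: (boolP (x \in G)) => // /set_mem Gx; rewrite mem_set//.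
    by rewrite /H/= dotpD lerD.
Qed.

(** The hypothesis on Q is the shifted moment identity of a quadratic form, with a the mean and q
    its variance term. Required for all shifts u, it reproduces itself under convolution, doubling a
    and q, without expanding Q. *)
Lemma conv_moment (Q : vec R n -> R) (a : vec R n) (q : R) : 0 <= q ->
  (forall x, 0 <= Q x) -> measurable_fun setT Q ->
  (forall u, \int[leb]_x ((Q (vadd x u))%:E * (F x)%:E) = (Q (vadd a u) + q)%:E)%E ->
  (forall u, \int[leb]_x ((Q (vadd x u))%:E * (conv F x)%:E) =
    (Q (vadd (vadd a a) u) + (q + q))%:E)%E.
Proof.
move=> q0 Q0 mQ QF u.
have mQv v : measurable_fun setT (fun x => (Q (vadd x v))%:E).
  by apply/measurable_EFinP; apply: (measurableT_comp mQ); exact: measurable_vadd.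
have mEF : measurable_fun setT (fun x => (F x)%:E) by exact/measurable_EFinP.
rewrite integral_conv//; last by move=> x; rewrite lee_fin.
have vaddA (x y z : vec R n) : vadd (vadd x y) z = vadd x (vadd y z).
  by apply/eq_from_tnth => i; rewrite !tnth_mktuple addrA.
transitivity (\int[leb]_y ((Q (vadd y (vadd a u)))%:E * (F y)%:E + q%:E * (F y)%:E))%E.
  apply: eq_integral => y _; under eq_integral do rewrite vaddA.
  rewrite QF (_ : vadd a (vadd y u) = vadd y (vadd a u)); last first.
    by apply/eq_from_tnth => i; rewrite !tnth_mktuple addrCA.
  by rewrite EFinD muleDr// (muleC (F y)%:E) (muleC (F y)%:E).
rewrite ge0_integralD//; last 4 first.
- by move=> x _; rewrite mule_ge0 ?lee_fin.
- exact: emeasurable_funM.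
- by move=> x _; rewrite mule_ge0 ?lee_fin.
- exact: measurable_funeM.
rewrite QF ge0_integralZl// ?lee_fin//; last by move=> x _; rewrite lee_fin.
by rewrite F1 mule1 -vaddA -EFinD addrA.
Qed.

End conv_theory.
End convolution.

Section hyperplane.
Context {R : realType}.

Lemma measurable_hyperplane n (u : vec R n) t :
  measurable [set x | dotp u x = t].
Proof.
rewrite (_ : mkset _ = dotp u @^-1` [set t])// -[X in measurable X]setTI.
by apply: measurable_dotp => //; exact: measurable_set1.
Qed.

(** If the head coefficient vanishes, each slice is a hyperplane of lower dimension. Otherwise each
    line parallel to the first axis meets the hyperplane in a single point. *)
Lemma lebn_hyperplane n (u : vec R n) t : nonzero_vec u ->
  lebn n [set x | dotp u x = t] = 0%E.
Proof.
elim: n u t => [|n ih] u t u0; first by case: u0 => -[].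
have mH m v (r : R) : measurable_fun setT
    (fun x : vec R m => (\1_[set x | dotp v x = r] x)%:E : \bar R).
  apply/measurable_EFinP; apply: measurable_indic; exact: measurable_hyperplane.
have HE m v (r : R) : (lebn m [set x | dotp v x = r] =
    \int[lebn m]_x (\1_[set x | dotp v x = r] x)%:E)%E.
  by rewrite integral_indic// ?setIT//; exact: measurable_hyperplane.
case E : (vuncons u) => [a w]; have {E}uE : u = vcons (a, w) by rewrite -E vunconsK.
rewrite HE; have [a0|a0] := eqVneq a 0.
  have w0 : nonzero_vec w.
    case: u0 => i; rewrite uE; case: (unliftP ord0 i) => [j ->|->].
      by rewrite tnthS => wj; exists j.
    by rewrite /= a0 eqxx.
  rewrite integral_lebnS//; apply: integral0_eq => s _.
  rewrite -(ih w t w0) HE; apply: eq_integral => z _.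
  rewrite !indicE; congr (_%:R%:E); congr nat_of_bool.
  by apply/idP/idP; rewrite !inE/= (dotp_vcons _ _ uE) a0 mul0r add0r.
rewrite integral_lebnS_swap//; apply: integral0_eq => z _.
rewrite -[RHS](lebesgue_measure_set1 ((t - dotp w z) / a)).
rewrite -[in RHS](setIT [set _]) -integral_indic//.
apply: eq_integral => s _; rewrite !indicE; congr (_%:R%:E); congr nat_of_bool.
apply/idP/idP; rewrite !inE/= (dotp_vcons _ _ uE).
  by move=> <-; rewrite addrK mulrAC divff// mul1r.
by move=> ->; rewrite mulrC divfK// subrK.
Qed.

End hyperplane.

Section iterated_convolution.
Context {R : realType} {n : nat}.
Local Notation leb := (lebn (R := R) n).
Variables (M : R) (f : vec R n -> R).
Hypothesis fM : lc_density M f.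

Lemma iter_conv_lc_density j : lc_density M (iter j conv f).
Proof. by elim: j => //= j; exact: conv_lc_density. Qed.

Lemma iter_conv_halfspace j u t p : 0 <= p ->
  (p%:E <= \int[leb]_x ((\1_[set x | (t <= dotp u x)%R] x)%:E * (f x)%:E))%E ->
  ((p ^+ (2 ^ j))%:E <=
    \int[leb]_x ((\1_[set x | (t *+ 2 ^ j <= dotp u x)%R] x)%:E *
      (iter j conv f x)%:E))%E.
Proof.
move=> p0 pf; elim: j => [|j ih]; first by rewrite expn0 expr1 mulr1n.
have := conv_halfspace (iter_conv_lc_density j) (exprn_ge0 _ p0) ih.
by rewrite -exprM -mulrnDr addnn -mul2n -expnS mulnC -expnS.
Qed.

Definition vmuln (a : vec R n) k : vec R n := [tuple tnth a i *+ k | i < n].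

Lemma iter_conv_moment j (Q : vec R n -> R) (a : vec R n) (q : R) : 0 <= q ->
  (forall x, 0 <= Q x) -> measurable_fun setT Q ->
  (forall u, \int[leb]_x ((Q (vadd x u))%:E * (f x)%:E) = (Q (vadd a u) + q)%:E)%E ->
  (forall u, \int[leb]_x ((Q (vadd x u))%:E * (iter j conv f x)%:E) =
    (Q (vadd (vmuln a (2 ^ j)) u) + q *+ 2 ^ j)%:E)%E.
Proof.
move=> q0 Q0 mQ Qf; elim: j => [|j ih] u.
  rewrite expn0 mulr1n (_ : vmuln a 1 = a)//.
  by apply/eq_from_tnth => i; rewrite tnth_mktuple.
rewrite (conv_moment (iter_conv_lc_density j) _ Q0 mQ ih) ?mulrn_wge0//.
rewrite expnS mul2n -addnn mulrnDr.
rewrite (_ : vadd (vmuln _ _) (vmuln _ _) = vmuln a (2 ^ j + 2 ^ j))//.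
by apply/eq_from_tnth => i; rewrite !tnth_mktuple mulrnDr.
Qed.

End iterated_convolution.

(** * Half-space mass of convolution powers *)

Section tail.
Context {R : realType} {n : nat}.
Local Notation leb := (lebn (R := R) n).
Variables (M : R) (F : vec R n -> R).
Hypothesis FM : lc_density M F.

Let F0 x : 0 <= F x. Proof. by case: FM => /(_ x)/andP[]. Qed.
Let mF : measurable_fun setT F. Proof. by case: FM. Qed.
Let mEF : measurable_fun setT (fun x => (F x)%:E). Proof. exact/measurable_EFinP. Qed.

Lemma measurable_sublevel c : measurable [set x | F x < c].
Proof.
rewrite (_ : mkset _ = F @^-1` `]-oo, c[%classic); last first.
  by apply/seteqP; split => x /=; rewrite in_itv.
by rewrite -[X in measurable X]setTI; exact: mF.
Qed.

(* Below the level e^(-2s) F(p), log-concavity at the midpoint with p gives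
   F(x) <= e^(-s) F((x + p) / 2). *)
Lemma integral_sublevel p s : 0 < F p ->
  (\int[leb]_x ((\1_[set x | (F x < expR (- (s + s)) * F p)%R] x)%:E * (F x)%:E) <=
   (2 ^+ n * expR (- s))%:E)%E.
Proof.
move=> Fp; set A := mkset _.
have mA : measurable A by exact: measurable_sublevel.
have h0 : (0 : R) < 2^-1 by rewrite invr_gt0.
(* With this b, the midpoint of x and p is an affine image of x; undoing the contraction by 1/2
   produces the factor 2^n. *)
pose b : vec R n := [tuple 2^-1 * tnth p i | i < n].
have combE x : comb 2^-1 x p = vscale 2^-1 b x.
  by apply/eq_from_tnth => i; rewrite !tnth_mktuple; field.
have mG : measurable_fun setT (fun x => (F (vscale 2^-1 b x))%:E).
  by apply: (measurableT_comp mEF); exact: measurable_vscale.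
apply: (@le_trans _ _ (\int[leb]_x ((expR (- s))%:E * (F (vscale 2^-1 b x))%:E))%E).
  apply: ge0_le_integral => //.
  - by move=> x _; rewrite mule_ge0 ?lee_fin.
  - by apply: emeasurable_funM => //; apply/measurable_EFinP; exact: measurable_indic.
  - exact: measurable_funeM.
  - move=> x _; rewrite -!EFinM lee_fin -combE.
    have [Ax|Ax] := pselect (A x); last first.
      by rewrite indicE memNset// mul0r mulr_ge0 ?expR_ge0.
    rewrite indicE mem_set// mul1r.
    have [Fx0|Fx0] := leP (F x) 0; first by rewrite (le_trans Fx0)// mulr_ge0 ?expR_ge0.
    have h01 : 0 < (2^-1 : R) < 1 by rewrite h0 invf_lt1// ltr1n.
    have [_ _ _ lcF] := FM.
    have /geom_leP := lcF 2^-1 x p h01; move=> /(_ h01 Fx0 Fp) H.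
    rewrite -(ler_pM2l (expR_gt0 (- s))) in H; apply: le_trans H.
    rewrite -expRD -[leLHS]lnK ?posrE// ler_expR.
    have : ln (F x) < - (s + s) + ln (F p).
      by rewrite -ltr_expR expRD !lnK.
    have -> : 1 - 2^-1 = 2^-1 :> R by field.
    by lra.
rewrite ge0_integralZl ?lee_fin ?expR_ge0//; last by move=> x _; rewrite lee_fin.
have : (\int[leb]_x (F x)%:E = 1)%E by case: FM.
rewrite (integral_vscale b h0 mEF) => [|x]; last by rewrite lee_fin.
set I := (\int[leb]_x _)%E => HI.
have c1 : 2 ^+ n * 2^-1 ^+ n = 1 :> R by rewrite -exprMn divff ?expr1n.
have -> : I = (2 ^+ n)%:E.
  transitivity ((2 ^+ n * 2^-1 ^+ n)%:E * I)%E; first by rewrite c1 mul1e.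
  by rewrite EFinM -muleA HI mule1.
by rewrite -EFinM mulrC lexx.
Qed.

End tail.

Section depth.
Context {R : realType} {n : nat}.
Local Notation leb := (lebn (R := R) n.+1).
Variables (M : R) (f : vec R n.+1 -> R).
Hypothesis fM : lc_density M f.

(** The level set of F is convex and misses K x, so a half-space with K x on its boundary meets it
    only in that boundary. Here r is any lower bound for the f-mass of the corresponding half-space
    through x. *)
Lemma halfspace_off_level j p x s : 0 < iter j conv f p ->
  iter j conv f (vmuln x (2 ^ j)) < expR (- (s + s)) * iter j conv f p ->
  exists2 u, nonzero_vec u & forall r, 0 <= r ->
    (r%:E <= \int[leb]_y
      ((\1_[set y | (dotp u x <= dotp u y)%R] y)%:E * (f y)%:E))%E ->
    r ^+ (2 ^ j) <= 2 ^+ n.+1 * expR (- s).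
Proof.
set F := iter j conv f => Fp Fx; have FM := iter_conv_lc_density fM j.
have F0 y : 0 <= F y by case: FM => /(_ y)/andP[].
have mF : measurable_fun setT F by case: FM.
have mEF : measurable_fun setT (fun x => (F x)%:E) by exact/measurable_EFinP.
pose c := expR (- (s + s)) * F p.
have c0 : 0 < c by rewrite mulr_gt0 ?expR_gt0.
have cC : convex_vset [set y | c <= F y].
  by apply: lconcave_superlevel => //; case: FM.
have [|u u0 uC] := convex_separation cC (z := vmuln x (2 ^ j)).
  by apply/negP; rewrite -ltNge.
exists u => // r r0 rf.
have := iter_conv_halfspace fM j r0 rf; rewrite -/F => rF.
have dE : dotp u (vmuln x (2 ^ j)) = dotp u x *+ 2 ^ j.
  by rewrite /dotp -sumrMnl; apply: eq_bigr => i _; rewrite tnth_mktuple mulrnAr.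
set t := _ *+ _ in rF dE.
rewrite -lee_fin; apply: le_trans rF _; apply: le_trans (integral_sublevel FM s Fp).
(* The added zero becomes the F-mass of the bounding hyperplane N: separation is weak, so H is
   contained in the union of A and N but not necessarily in A. *)
rewrite -/c -[leRHS]adde0.
set H := [set y | t <= _]; set A := mkset _; set N := [set y | dotp u y = t].
have mI (D : set (vec R n.+1)) : measurable D ->
    measurable_fun setT (fun y => (\1_D y)%:E : \bar R).
  by move=> mD; apply/measurable_EFinP; exact: measurable_indic.
have mN : measurable N by exact: measurable_hyperplane.
have mH : measurable H by exact: measurable_halfspace.
have mA : measurable A by exact: (measurable_sublevel FM).
have M0 : 0 <= M by case: FM => /(_ x)/andP[F0x FxM] _ _ _; exact: le_trans FxM.
have hyp0 : (\int[leb]_y ((\1_N y)%:E * (F y)%:E) = 0)%E.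
  apply/eqP; rewrite eq_le; apply/andP; split; last first.
    by apply: integral_ge0 => y _; rewrite mule_ge0 ?lee_fin.
  have <- : (\int[leb]_y (M%:E * (\1_N y)%:E) = 0)%E.
    rewrite ge0_integralZl ?lee_fin//; last first.
      exact: mI.
    rewrite integral_indic// setIT [X in (_ * X)%E](lebn_hyperplane t u0).
    by rewrite mule0.
  apply: ge0_le_integral => //.
  - by move=> y _; rewrite mule_ge0 ?lee_fin.
  - by apply: emeasurable_funM => //; exact: mI.
  - by apply: measurable_funeM; exact: mI.
  - move=> y _; rewrite muleC lee_wpmul2r ?lee_fin//.
    by case: FM => /(_ y)/andP[].
rewrite -hyp0 -ge0_integralD//; last 4 first.
- by move=> y _; rewrite mule_ge0 ?lee_fin.
- by apply: emeasurable_funM => //; exact: mI.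
- by move=> y _; rewrite mule_ge0 ?lee_fin.
- by apply: emeasurable_funM => //; exact: mI.
apply: ge0_le_integral => //.
- by move=> y _; rewrite mule_ge0 ?lee_fin.
- by apply: emeasurable_funM => //; exact: mI.
- by apply: emeasurable_funD; apply: emeasurable_funM => //; exact: mI.
- move=> y _; rewrite -!EFinM -EFinD lee_fin -mulrDl ler_wpM2r// !indicE.
  rewrite -natrD ler_nat.
  have [Hy|Hy] := pselect (H y); last by rewrite memNset.
  have [Fy|Fy] := ltP (F y) c; first by rewrite [y \in A]mem_set// (leq_trans (leq_b1 _))// leq_addr.
  rewrite [y \in N]mem_set; first by rewrite addn1 (leq_trans (leq_b1 _)).
  by apply/eqP; rewrite eq_le -dE uC// dE.
Qed.

End depth.

(** * Gaussian integrals *)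

Section schur.
Context {R : fieldType}.

Definition schur n (B : 'M[R]_n.+1) : 'M[R]_n :=
  \matrix_(i, j) (B (lift ord0 i) (lift ord0 j) -
    B (lift ord0 i) ord0 * B ord0 (lift ord0 j) / B ord0 ord0).

Lemma det_schur n (B : 'M[R]_n.+1) : B ord0 ord0 != 0 ->
  \det B = B ord0 ord0 * \det (schur B).
Proof.
move=> a0; set a := B ord0 ord0.
pose A : 'M[R]_(1 + n) := B.
have ulA : ulsubmx A = a%:M.
  apply/matrixP => i j; rewrite !ord1 !mxE eqxx mulr1n.
  by rewrite !lshift0.
(* Right multiplication by U clears the first row beyond its head entry and leaves a lower
   block-triangular matrix. *)
pose U : 'M[R]_(1 + n) := block_mx 1%:M (- a^-1 *: ursubmx A) 0 1%:M.
have detU : \det U = 1 by rewrite det_ublock !det1 mulr1.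
rewrite -[LHS]mulr1 -detU -[\det B]/(\det A) -det_mulmx -(submxK A) mulmx_block.
rewrite !mulmx1 !mulmx0 !addr0 ulA mul_scalar_mx scalerA mulrN divff// scaleN1r.
rewrite addNr det_lblock det_scalar1; congr (_ * \det _).
apply/matrixP => i j; rewrite !mxE big_ord1 !mxE !lshift0 !rshift1.
by rewrite addrC; congr (_ + _); rewrite -/a; field.
Qed.

End schur.

Section gauss.
Context {R : realType}.
Local Notation mu := (@lebesgue_measure R).

Definition qform n (B : 'M[R]_n) (x : vec R n) : R :=
  \sum_(i < n) \sum_(j < n) B i j * (tnth x i * tnth x j).

Definition posdef n (B : 'M[R]_n) :=
  forall x : vec R n, nonzero_vec x -> 0 < qform B x.

Lemma measurable_qform n (B : 'M[R]_n) : measurable_fun setT (qform B).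
Proof.
apply: measurable_sum => i; apply: measurable_sum => j.
apply: measurable_funM => //; apply: measurable_funM; exact: measurable_tnth.
Qed.

(* Completing the square in the first coordinate. *)
Lemma qform_vcons n (B : 'M[R]_n.+1) s z : B^T = B -> B ord0 ord0 != 0 ->
  qform B (vcons (s, z)) =
  B ord0 ord0 * (s + (\sum_(j < n) B ord0 (lift ord0 j) * tnth z j) /
    B ord0 ord0) ^+ 2 + qform (schur B) z.
Proof.
move=> symB a0; set a := B ord0 ord0; set w := \sum_(j < n) _.
have sym i j : B i j = B j i by rewrite -[in LHS]symB mxE.
have -> : qform (schur B) z = \sum_(i < n) \sum_(j < n)
    B (lift ord0 i) (lift ord0 j) * (tnth z i * tnth z j) - w ^+ 2 / a.
  rewrite expr2 /w big_distrl /= mulr_suml -sumrB; apply: eq_bigr => i _.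
  rewrite mulr_sumr mulr_suml -sumrB; apply: eq_bigr => j _.
  by rewrite mxE (sym _ ord0) -/a; field.
have x0 : tnth (vcons (s, z)) ord0 = s by [].
rewrite {1}/qform big_ord_recl big_ord_recl.
have -> : \sum_(i < n) B ord0 (lift ord0 i) *
    (tnth (vcons (s, z)) ord0 * tnth (vcons (s, z)) (lift ord0 i)) = s * w.
  by rewrite mulr_sumr; apply: eq_bigr => i _; rewrite tnthS x0; ring.
have -> : \sum_(i < n) \sum_(j < n.+1) B (lift ord0 i) j *
    (tnth (vcons (s, z)) (lift ord0 i) * tnth (vcons (s, z)) j) =
  s * w + \sum_(i < n) \sum_(j < n)
    B (lift ord0 i) (lift ord0 j) * (tnth z i * tnth z j).
  rewrite mulr_sumr -big_split; apply: eq_bigr => i _ /=.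
  rewrite big_ord_recl !tnthS x0 (sym (lift ord0 i) ord0); congr (_ + _); first ring.
  by apply: eq_bigr => j _; rewrite !tnthS.
rewrite !x0 -/a; set D := \sum_(i < n) _.
by have := a0; rewrite -/a => a0'; field.
Qed.

Lemma posdef_diag n (B : 'M[R]_n.+1) : posdef B -> 0 < B ord0 ord0.
Proof.
move=> pB; have := pB (vcons (1, vzero n)) _; rewrite {1}/qform.
rewrite big_ord_recl big_ord_recl big1 => [|i _]; last first.
  by rewrite tnthS tnth_mktuple mulr0 mulr0.
rewrite big1 => [|i _].
  rewrite /= !mulr1 !addr0; apply; exists ord0; exact: oner_neq0.
by apply: big1 => j _; rewrite tnthS tnth_mktuple mul0r mulr0.
Qed.

Lemma schur_sym n (B : 'M[R]_n.+1) : B^T = B -> (schur B)^T = schur B.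
Proof.
move=> symB; have sym i j : B i j = B j i by rewrite -[in LHS]symB mxE.
apply/matrixP => i j; rewrite !mxE; congr (_ - _); first by rewrite sym.
rewrite (sym (lift ord0 j) ord0) (sym ord0 (lift ord0 i)); congr (_ / _).
exact: mulrC.
Qed.

Lemma schur_posdef n (B : 'M[R]_n.+1) : B^T = B -> posdef B -> posdef (schur B).
Proof.
move=> symB pB z [i zi]; have a0 := posdef_diag pB.
pose s := - ((\sum_(j < n) B ord0 (lift ord0 j) * tnth z j) / B ord0 ord0).
have := pB (vcons (s, z)) _; rewrite qform_vcons// ?gt_eqF// addNr expr0n mulr0 add0r.
by apply; exists (lift ord0 i); rewrite tnthS.
Qed.

Lemma posdef_det n (B : 'M[R]_n) : B^T = B -> posdef B -> 0 < \det B.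
Proof.
elim: n B => [|n ih] B symB pB; first by rewrite det_mx00.
have a0 := posdef_diag pB; rewrite det_schur ?gt_eqF// mulr_gt0//.
by apply: ih; [exact: schur_sym|exact: schur_posdef].
Qed.

Let measurable_gauss1 (a c : R) : measurable_fun setT
  (fun s : measurableTypeR R => (expR (- (a * (s + c) ^+ 2) / 2))%:E).
Proof.
apply/measurable_EFinP; apply: measurableT_comp => //.
apply: measurable_funM => //; apply: measurableT_comp => //.
by apply: measurable_funM => //; apply: measurable_funX; exact: measurable_funD.
Qed.

(** Read off from the normal density with mean -c and standard deviation 1 / sqrt(a), which has
    total mass 1. *)
Let gauss1 (a c : R) : 0 < a ->
  (\int[mu]_s (expR (- (a * (s + c) ^+ 2) / 2))%:E =
    (Num.sqrt (2 * pi) / Num.sqrt a)%:E)%E.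
Proof.
move=> a0; pose sg := (Num.sqrt a)^-1.
have sa : 0 < Num.sqrt a by rewrite sqrtr_gt0.
have sg0 : sg != 0 by rewrite invr_eq0 gt_eqF.
have := @integral_normal_pdf R (- c) sg.
have pk : 0 < normal_peak sg.
  by rewrite invr_gt0 sqrtr_gt0 mulrn_wgt0// mulr_gt0 ?pi_gt0// exprn_even_gt0.
have sgE : sg ^+ 2 = a^-1 by rewrite exprVn sqr_sqrtr// ltW.
rewrite (_ : (fun x => _) = fun x : measurableTypeR R =>
    ((normal_peak sg)%:E * (expR (- (a * (x + c) ^+ 2) / 2))%:E)%E); last first.
  apply/funext => x; rewrite normal_pdfE// -EFinM /normal_fun; congr ((_ * expR _)%:E).
  by rewrite opprK sgE; field; rewrite gt_eqF.
rewrite ge0_integralZl//; last by rewrite lee_fin ltW.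
set I := (\int[_]_x _)%E => HI.
have -> : I = ((normal_peak sg)^-1)%:E.
  transitivity (((normal_peak sg)^-1 * normal_peak sg)%:E * I)%E.
    by rewrite mulVf ?gt_eqF// mul1e.
  by rewrite EFinM -muleA HI mule1.
have -> : (normal_peak sg)^-1 = Num.sqrt ((2 * pi) * a^-1).
  by rewrite /normal_peak invrK sgE mulrC -mulrnAl mulr_natl.
by rewrite sqrtrM ?mulr_ge0 ?pi_ge0// sqrtrV// ltW.
Qed.

(** After completing the square, the head coordinate integrates to sqrt(2 pi / B_00) and leaves the
    Gaussian of the Schur complement, which is again symmetric positive definite; the determinants
    multiply accordingly. *)
Lemma gauss_integral n (B : 'M[R]_n) : B^T = B -> posdef B ->
  (\int[lebn n]_x (expR (- qform B x / 2))%:E =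
    (Num.sqrt (2 * pi) ^+ n / Num.sqrt (\det B))%:E)%E.
Proof.
have mE m (C : 'M[R]_m) :
    measurable_fun setT (fun x : vec R m => (expR (- qform C x / 2))%:E).
  apply/measurable_EFinP; apply: measurableT_comp => //.
  apply: measurable_funM => //; apply: measurableT_comp => //.
  exact: measurable_qform.
elim: n B => [|n ih] B symB pB.
  by rewrite integral_lebn0// /qform big_ord0 oppr0 mul0r expR0 det_mx00 sqrtr1 invr1 mulr1.
have a0 := posdef_diag pB; rewrite integral_lebnS_swap//.
transitivity (\int[lebn n]_z ((expR (- qform (schur B) z / 2))%:E *
    (Num.sqrt (2 * pi) / Num.sqrt (B ord0 ord0))%:E))%E.
  apply: eq_integral => z _.
  rewrite -(@gauss1 _ ((\sum_(j < n) B ord0 (lift ord0 j) * tnth z j) /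
    B ord0 ord0) a0) -ge0_integralZl//.
  apply: eq_integral => s _; rewrite -EFinM -expRD qform_vcons// ?gt_eqF//.
  by congr (expR _)%:E; ring.
rewrite ge0_integralZr ?lee_fin ?divr_ge0//; last exact: mE.
have symS := schur_sym symB; have pS := schur_posdef symB pB.
rewrite ih// -EFinM det_schur ?gt_eqF// (sqrtrM _ (ltW a0)); congr (_%:E).
rewrite exprS invfM; set u := _ ^+ n; set v := Num.sqrt (2 * pi).
by rewrite mulrACA [u * v]mulrC [X in _ * X]mulrC.
Qed.

End gauss.

(** * Covariance of a log-concave measure *)

Section density.
Context d {T : measurableType d} {R : realType}.
Local Notation mu := (@lebesgue_measure R).

(** Layer cake reduces the integral of g to the masses of its superlevel sets, where the density
    formula applies; Tonelli then reassembles g. *)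
Lemma integral_density (m : {sigma_finite_measure set T -> \bar R})
    (P : probability T R) (f : T -> R) (g : T -> \bar R) :
  (forall x, 0 <= f x) -> measurable_fun setT f ->
  (forall A, measurable A -> P A = \int[m]_(x in A) (f x)%:E)%E ->
  measurable_fun setT g -> (forall x, 0 <= g x)%E ->
  (\int[P]_x g x = \int[m]_x (g x * (f x)%:E))%E.
Proof.
move=> f0 mf Pf mg g0; rewrite [LHS](layer_cake P)//.
pose E := [set p : T * measurableTypeR R | ((p.2 : R)%:E < g p.1)%E].
have mE : measurable E by exact: measurable_hypograph.
pose D : set (measurableTypeR R) := `]0, +oo[%classic.
have mD : measurable D by exact: measurable_itv.
have mEf : measurable_fun setT (fun x => (f x)%:E) by exact/measurable_EFinP.
have mset s : measurable [set x | (s%:E < g x)%E].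
  by rewrite -[X in measurable X]setTI; exact: emeasurable_fun_o_infty.
transitivity (\int[mu]_s \int[m]_x
    ((\1_E (x, s))%:E * (f x)%:E * (\1_D s)%:E))%E.
  rewrite integral_mkcond; apply: eq_integral => s _; rewrite epatch_indic.
  rewrite ge0_integralZr ?lee_fin//; last 2 first.
  - apply: emeasurable_funM => //; apply/measurable_EFinP.
    exact: (measurable_indic (mset s)).
  - by move=> x _; rewrite mule_ge0 ?lee_fin.
  rewrite [X in (X * _)%E](Pf _ (mset s)); congr (_ * _)%E.
  rewrite [LHS]integral_mkcond; apply: eq_integral => x _.
  by rewrite epatch_indic muleC; congr (_%:R%:E * _)%E; congr nat_of_bool;
    apply/idP/idP; rewrite !inE.
rewrite -(fubini_tonelli (fun p : T * measurableTypeR R =>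
    (\1_E p)%:E * (f p.1)%:E * (\1_D p.2)%:E)%E); last 2 first.
- apply: emeasurable_funM; last first.
    apply/measurable_EFinP.
    exact: (measurableT_comp (measurable_indic mD)).
  apply: emeasurable_funM; last exact: (measurableT_comp mEf).
  by apply/measurable_EFinP; exact: measurable_indic.
- by move=> p; rewrite !mule_ge0 ?lee_fin.
(* Layer cake for the Dirac mass at x writes the single value g x as the length of the levels below
   it. *)
apply: eq_integral => x _; have := integral_dirac x measurableT mg.
rewrite diracT mul1e => <-.
rewrite [X in _ = (X * _)%E](layer_cake (dirac x))// [X in _ = (X * _)%E]integral_mkcond.
rewrite -ge0_integralZr ?lee_fin//; last 2 first.
- apply/(measurable_restrictT _ _).1 => //; apply: (measurable_funS measurableT) => //.
  exact: (measurable_superlevel (dirac x) mg).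
- by move=> s _; apply: erestrict_ge0.
apply: eq_integral => s _; rewrite epatch_indic /= muleAC; congr (_ * _ * _)%E.
Qed.

Lemma density_indic (m : {measure set T -> \bar R}) (P : probability T R)
    (f : T -> R) (A : set T) :
  (forall A, measurable A -> P A = \int[m]_(x in A) (f x)%:E)%E ->
  measurable A -> (P A = \int[m]_x ((\1_A x)%:E * (f x)%:E))%E.
Proof.
move=> Pf mA; rewrite Pf// [LHS]integral_mkcond; apply: eq_integral => x _.
by rewrite epatch_indic muleC.
Qed.

End density.

(** * Finite second moments from tail decay *)

Section second_moment.
Context {R : realType} {n : nat}.
Variables (mu : probability (vec R n) R) (f : vec R n -> R).
Hypothesis f0 : forall x, 0 <= f x.
Hypothesis mf : measurable_fun setT f.
Hypothesis muf :
  forall A, measurable A -> (mu A = \int[lebn n]_(x in A) (f x)%:E)%E.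
Hypothesis lcf : lconcave f.

Let muE A : measurable A -> (mu A = \int[lebn n]_x ((\1_A x)%:E * (f x)%:E))%E.
Proof. exact: density_indic. Qed.
Lemma log_concave_measure_of_density l A B C : 0 < l < 1 ->
  measurable A -> measurable B -> measurable C ->
  (forall x y, A x -> B y -> C (comb l x y)) -> geom_le l (mu A) (mu B) (mu C).
Proof.
move=> l01 mA mB mC ABC; rewrite !muE//.
have mI D : measurable D -> measurable_fun setT (fun x => (\1_D x)%:E * (f x)%:E)%E.
  move=> mD; apply: emeasurable_funM; last exact/measurable_EFinP.
  by apply/measurable_EFinP; exact: measurable_indic.
apply: prekopa_leindler => //; try exact: mI.
- by move=> x; rewrite mule_ge0 ?lee_fin.
- by move=> x; rewrite mule_ge0 ?lee_fin.
- by move=> x; rewrite mule_ge0 ?lee_fin.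
move=> x y a b; rewrite -!EFinM.
have [Ax|Ax] := pselect (A x); last first.
  by rewrite indicE memNset// mul0r lte_fin ltNge expR_ge0.
have [By|By] := pselect (B y); last first.
  by move=> _; rewrite [\1_B y]indicE memNset// mul0r lte_fin ltNge expR_ge0.
by rewrite !indicE !mem_set ?mul1r//; [exact: lcf|exact: ABC].
Qed.

Variable i : 'I_n.

Let T (r : R) := [set x : vec R n | r < `|tnth x i|].
Let t r := fine (mu (T r)).

Let mT r : measurable (T r).
Proof.
rewrite (_ : T r = (fun x : vec R n => `|tnth x i|) @^-1` `]r, +oo[%classic).
  rewrite -[X in measurable X]setTI.
  have mn : measurable_fun setT (fun x : vec R n => `|tnth x i|).
    by apply: measurableT_comp => //; exact: measurable_tnth.
  exact: mn.
by apply/seteqP; split => x /=; rewrite in_itv/= andbT.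
Qed.

Let tE r : mu (T r) = (t r)%:E.
Proof. by rewrite /t fineK// fin_num_measure. Qed.

Let t_ge0 r : 0 <= t r. Proof. by rewrite fine_ge0. Qed.

(** A form of Borell's lemma: if |x_i| <= r and |y_i| > 3r, the midpoint has coordinate larger than
    r in absolute value, so log-concavity of mu compares the three masses. *)
Let tail_step r : 0 <= r -> (1 - t r) * t (3 * r) <= t r ^+ 2.
Proof.
move=> r0; have h01 : 0 < (2^-1 : R) < 1 by rewrite invr_gt0 ltr0n/= invf_lt1// ltr1n.
have := @log_concave_measure_of_density 2^-1 (~` T r) (T (3 * r)) (T r) h01
  (measurableC (mT r)) (mT _) (mT _).
rewrite probability_setC// !tE -EFinB => H.
have {}H : geom_le 2^-1 (1 - t r)%:E (t (3 * r))%:E (t r)%:E.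
  apply: H => x y; rewrite /T/= => /negP; rewrite -leNgt => xr yr.
  rewrite tnth_mktuple.
  have h0 : 0 <= 2^-1 :> R by rewrite invr_ge0.
  have -> : 1 - 2^-1 = 2^-1 :> R by field.
  have := ler_normD (2^-1 * tnth x i + 2^-1 * tnth y i) (- (2^-1 * tnth x i)).
  rewrite normrN addrAC subrr add0r (normrM _ (tnth y i)) (normrM _ (tnth x i)).
  by rewrite (ger0_norm h0); lra.
have [p0|p0] := leP (1 - t r) 0.
  by apply: le_trans (sqr_ge0 _); rewrite mulr_le0_ge0.
have [q0|q0] := leP (t (3 * r)) 0.
  by apply: le_trans (sqr_ge0 _); rewrite mulr_ge0_le0// ltW.
have /geom_leP := H; move=> /(_ h01 p0 q0).
rewrite -ler_sqr ?nnegrE ?expR_ge0//; apply: le_trans.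
rewrite expr2 -expRD (_ : _ + _ = ln (1 - t r) + ln (t (3 * r))); last by field.
by rewrite expRD !lnK.
Qed.

(** With t(r) <= 1/28, [tail_step] gives (27/28) t(3r) <= t(r)/28: tripling r divides the tail by
    27, which beats the factor 9 gained by the square. *)
Let small_tail : exists2 r, 0 < r & t r <= 28^-1.
Proof.
have cvgT : mu (~` T k%:R) @[k --> \oo] --> mu [set: vec R n].
  rewrite (_ : [set: vec R n] = \bigcup_k (~` T k%:R)).
    apply: nondecreasing_cvg_mu.
    - by move=> k; exact: measurableC.
    - by apply: bigcupT_measurable => k; exact: measurableC.
    - move=> j k jk; apply/subsetPset => x /=; apply: contra_not.
      by apply: le_lt_trans; rewrite ler_nat.
  apply/seteqP; split => // x _; exists (Num.truncn `|tnth x i|).+1 => //=.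
  by apply/negP; rewrite -leNgt ltW// truncnS_gt.
rewrite probability_setT in cvgT.
have lt1 : ((1 - 28^-1)%:E < 1 :> \bar R)%E.
  by rewrite lte_fin gtrBl invr_gt0.
have [k _ /(_ k.+1 (leqnSn k)) H] := cvgT _ (open_ereal_gt' lt1).
exists k.+1%:R => //; move: H; rewrite /= probability_setC// tE -EFinB lte_fin.
by rewrite ltrD2l ltrN2 => /ltW.
Qed.

Lemma second_moment_finite : (\int[mu]_x (tnth x i ^+ 2)%:E < +oo)%E.
Proof.
have [r r0 tr] := small_tail.
have rk k : 0 <= 3 ^+ k * r by rewrite mulr_ge0 ?exprn_ge0// ltW.
have tk k : t (3 ^+ k * r) <= 28^-1 * 27^-1 ^+ k.
  elim: k => [|k ih]; first by rewrite expr0 mul1r expr0 mulr1.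
  have s28 : t (3 ^+ k * r) <= 28^-1.
    apply: le_trans ih _; rewrite ler_piMr ?invr_ge0// exprn_ile1 ?invr_ge0//.
    by rewrite invf_le1// ler1n.
  have := tail_step (rk k); rewrite (exprS 3) (exprS 27^-1) -mulrA.
  have := t_ge0 (3 * (3 ^+ k * r)); have := t_ge0 (3 ^+ k * r).
  move: s28 ih; set a := t (3 ^+ k * r); set b := t _.
  set c := 27^-1 ^+ k; move=> s28 ih a0 b0 step.
  have : 27 / 28 * b <= 28^-1 * a.
    apply: le_trans (_ : (1 - a) * b <= _); first by rewrite ler_wpM2r//; lra.
    by apply: le_trans step _; rewrite expr2 ler_wpM2r.
  by lra.
pose g k (x : vec R n) := Num.min (tnth x i ^+ 2) (9 ^+ k * r ^+ 2).
have mg k : measurable_fun setT (fun x => (g k x)%:E).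
  apply/measurable_EFinP; apply: measurable_minr => //.
  by apply: measurable_funX; exact: measurable_tnth.
have g0 k x : 0 <= g k x by rewrite le_min sqr_ge0/= mulr_ge0 ?exprn_ge0// ltW.
(* Passing from k to k+1 costs at most 9^(k+1) r^2 t(3^k r) <= (9/28) r^2 3^(-k), while the bound
   grows by 10 r^2 3^(-k); at k = 0 it equals r^2. *)
have gI k : (\int[mu]_x (g k x)%:E <= (r ^+ 2 * (16 - 15 * 3^-1 ^+ k))%:E)%E.
  elim: k => [|k ih].
    apply: (@le_trans _ _ (\int[mu]_x (r ^+ 2)%:E)%E).
      apply: ge0_le_integral => //.
      - by move=> x _; rewrite lee_fin.
      - by move=> x _; rewrite lee_fin ge_min expr0 mul1r lexx orbT.
    rewrite integral_cst// [X in (_ * X)%E](probability_setT mu) mule1 lee_fin expr0 mulr1.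
    by rewrite ler_peMr ?sqr_ge0//; lra.
  apply: (@le_trans _ _ (\int[mu]_x ((g k x)%:E +
      (9 ^+ k.+1 * r ^+ 2)%:E * (\1_(T (3 ^+ k * r)) x)%:E))%E).
    apply: ge0_le_integral => //.
    - by move=> x _; rewrite lee_fin.
    - apply: emeasurable_funD => //; apply: emeasurable_funM => //.
      by apply/measurable_EFinP; exact: measurable_indic.
    - move=> x _; rewrite -EFinM -EFinD lee_fin indicE.
      have [Tx|Tx] := pselect (T (3 ^+ k * r) x).
        rewrite mem_set// mulr1 (le_trans (y := 9 ^+ k.+1 * r ^+ 2))//.
          by rewrite ge_min lexx orbT.
        by rewrite lerDr.
      rewrite memNset// mulr0 addr0 le_min ge_min lexx/= ge_min.
      apply/orP; left; move: Tx => /negP; rewrite -leNgt => Tx.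
      rewrite -real_normK ?num_real// (_ : 9 = 3 ^+ 2); last by ring.
      by rewrite exprAC -exprMn ler_sqr ?nnegrE.
  rewrite ge0_integralD//; last 3 first.
  - by move=> x _; rewrite lee_fin.
  - by move=> x _; rewrite mule_ge0 ?lee_fin// mulr_ge0 ?exprn_ge0// ltW.
  - apply: emeasurable_funM => //.
    by apply/measurable_EFinP; exact: measurable_indic.
  rewrite ge0_integralZl//; last 2 first.
  - by apply/measurable_EFinP; exact: measurable_indic.
  - by rewrite lee_fin mulr_ge0 ?exprn_ge0// ltW.
  rewrite integral_indic// setIT [X in (_ * X)%E](tE (3 ^+ k * r)) -EFinM.
  apply: le_trans (leeD2r _ ih) _; rewrite -EFinD lee_fin.
  have : 9 ^+ k.+1 * r ^+ 2 * t (3 ^+ k * r) <=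
      9 ^+ k.+1 * r ^+ 2 * (28^-1 * 27^-1 ^+ k).
    by rewrite ler_wpM2l// mulr_ge0 ?exprn_ge0// ltW.
  have -> : 9 ^+ k.+1 * r ^+ 2 * (28^-1 * 27^-1 ^+ k) = 9 / 28 * (r ^+ 2 * 3^-1 ^+ k).
    have -> : (3^-1 : R) = 9 * 27^-1 by field.
    by rewrite exprMn (exprS 9); ring.
  have : 0 <= r ^+ 2 * 3^-1 ^+ k by rewrite mulr_ge0 ?exprn_ge0// ltW.
  by rewrite (exprS 3^-1); set u := 3^-1 ^+ k; set w := 9 ^+ k.+1 * _ * _; lra.
apply: (@le_lt_trans _ _ (r ^+ 2 * 16)%:E); last exact: ltry.
have ndg x : {homo (fun k => (g k x)%:E) : j k / (j <= k)%N >-> (j <= k)%E}.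
  move=> j k jk; rewrite lee_fin le_min ge_min lexx/= ge_min; apply/orP; right.
  by rewrite ler_wpM2r ?sqr_ge0// ler_weXn2l// ler1n.
have -> : (\int[mu]_x (tnth x i ^+ 2)%:E = \int[mu]_x limn (fun k => (g k x)%:E))%E.
  apply: eq_integral => x _; apply/esym/cvg_lim => //; apply: cvg_near_cst.
  near=> k; congr EFin; apply/min_idPl.
  rewrite -ler_pdivrMr ?exprn_gt0//; apply: (@le_trans _ _ k%:R).
    by near: k; exact: nbhs_infty_ger.
  by rewrite -natrX ler_nat ltnW// ltn_expl.
rewrite monotone_convergence//; last by move=> k x _; rewrite lee_fin.
apply: lime_le.
  by apply: ereal_nondecreasing_is_cvgn => j k jk; apply: ge0_le_integral;
    [by []|by move=> x _; rewrite lee_fin|exact: mg|exact: mg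
    |by move=> x _; exact: ndg].
apply: nearW => k; apply: le_trans (gI k) _; rewrite lee_fin.
by rewrite ler_wpM2l ?sqr_ge0// gerBl mulr_ge0 ?exprn_ge0 ?invr_ge0.
Unshelve. all: by end_near. Qed.

End second_moment.

Section finite_integral.
Context d {T : measurableType d} {R : realType} (mu : probability T R).

(** Pairs integrability with a real value, so that linear combinations never meet the default value
    of [fine]. *)
Definition has_integral (h : T -> R) (v : R) :=
  mu.-integrable setT (EFin \o h) /\ (\int[mu]_x (h x)%:E = v%:E)%E.

Lemma has_integral_cst v : has_integral (cst v) v.
Proof.
split; first exact: finite_measure_integrable_cst.
transitivity (\int[mu]_x (cst v%:E) x)%E => //.
by rewrite integral_cst// [X in (_ * X)%E](probability_setT mu) mule1.
Qed.

Lemma has_integralD h k v w : has_integral h v -> has_integral k w ->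
  has_integral (fun x => h x + k x) (v + w).
Proof.
move=> [ih Ih] [ik Ik]; split; first exact: (integrableD measurableT ih ik).
by rewrite EFinD -Ih -Ik -integralD.
Qed.

Lemma has_integralZ c h v : has_integral h v ->
  has_integral (fun x => c * h x) (c * v).
Proof.
move=> [ih Ih]; split; first exact: (integrableZl measurableT c ih).
by rewrite EFinM -Ih -integralZl.
Qed.

Lemma has_integral_sum (I : Type) (s : seq I) (h : I -> T -> R) (v : I -> R) :
  (forall i, has_integral (h i) (v i)) ->
  has_integral (fun x => \sum_(i <- s) h i x) (\sum_(i <- s) v i).
Proof.
move=> H; elim: s => [|i s ih].
  rewrite big_nil (_ : (fun x => _) = cst 0); first exact: has_integral_cst.
  by apply/funext => x; rewrite big_nil.
rewrite big_cons (_ : (fun x => _) = fun x => h i x + \sum_(j <- s) h j x).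
  exact: has_integralD.
by apply/funext => x; rewrite big_cons.
Qed.

Lemma has_integral_dominated (h k : T -> R) v : measurable_fun setT h ->
  (forall x, `|h x| <= k x) -> has_integral k v ->
  has_integral h (fine (\int[mu]_x (h x)%:E)%E).
Proof.
move=> mh hk [ik _].
have ih : mu.-integrable setT (EFin \o h).
  apply: le_integrable ik => //; first exact/measurable_EFinP.
  move=> x _; rewrite /= lee_fin (le_trans (hk x))//.
  exact: ler_norm.
by split => //; rewrite fineK//; exact: integrable_fin_num.
Qed.

End finite_integral.

Section covariance.
Context {R : realType} {n : nat}.
Variables (mu : probability (vec R n) R) (f : vec R n -> R).
Hypothesis f0 : forall x, 0 <= f x.
Hypothesis mf : measurable_fun setT f.
Hypothesis muf :
  forall A, measurable A -> (mu A = \int[lebn n]_(x in A) (f x)%:E)%E.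
Hypothesis lcf : lconcave f.

Let sqr_has_integral i : exists v, has_integral mu (fun x => tnth x i ^+ 2) v.
Proof.
have fin := second_moment_finite f0 mf muf lcf i.
have m2 : measurable_fun setT (fun x : vec R n => tnth x i ^+ 2).
  by apply: measurable_funX; exact: measurable_tnth.
exists (fine (\int[mu]_x (tnth x i ^+ 2)%:E)%E); split.
  apply/integrableP; split; first exact/measurable_EFinP.
  by under eq_integral do rewrite gee0_abs ?lee_fin ?sqr_ge0//.
rewrite fineK// ge0_fin_numE// integral_ge0// => x _.
by rewrite lee_fin sqr_ge0.
Qed.

Let mean_has_integral i : has_integral mu (fun x => tnth x i) (mean mu i).
Proof.
have [v Hv] := sqr_has_integral i.
apply: (has_integral_dominated _ _ (has_integralD (has_integral_cst mu 1) Hv)).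
  exact: measurable_tnth.
move=> x /=; rewrite -[X in _ <= 1 + X]real_normK ?num_real//.
have := sqr_ge0 (`|tnth x i| - 1); have := normr_ge0 (tnth x i); nra.
Qed.

Lemma moment2_has_integral (u : vec R n) i j :
  has_integral mu (fun x => tnth (vadd x u) i * tnth (vadd x u) j)
    (cov mu i j + (mean mu i + tnth u i) * (mean mu j + tnth u j)).
Proof.
have [v Hv] := sqr_has_integral i; have [w Hw] := sqr_has_integral j.
have Hij : has_integral mu (fun x => tnth x i * tnth x j)
    (fine (\int[mu]_x (tnth x i * tnth x j)%:E)%E).
  apply: (has_integral_dominated _ _ (has_integralD Hv Hw)).
    by apply: measurable_funM; exact: measurable_tnth.
  move=> x /=; rewrite normrM -[in leRHS](real_normK (num_real (tnth x i))).
  rewrite -[X in _ <= _ + X]real_normK ?num_real//.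
  have := sqr_ge0 (`|tnth x i| - `|tnth x j|).
  have := normr_ge0 (tnth x i); have := normr_ge0 (tnth x j); nra.
have := has_integralD (has_integralD Hij
  (has_integralZ (tnth u j) (mean_has_integral i)))
  (has_integralD (has_integralZ (tnth u i) (mean_has_integral j))
    (has_integral_cst mu (tnth u i * tnth u j))).
rewrite mxE; set S := fine _ => H; congr has_integral: H.
  by apply/funext => x; rewrite !tnth_mktuple /=; ring.
by rewrite /=; ring.
Qed.

Definition mean_vec : vec R n := [tuple mean mu i | i < n].

(** This is the shifted moment identity that [iter_conv_moment] requires, with variance term the
    trace of B Cov(mu). *)
Lemma qform_has_integral (B : 'M[R]_n) (u : vec R n) :
  has_integral mu (fun x => qform B (vadd x u))
    (qform B (vadd mean_vec u) + \sum_(i < n) \sum_(j < n) B i j * cov mu i j).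
Proof.
have H : has_integral mu (fun x => qform B (vadd x u))
    (\sum_(i < n) \sum_(j < n) B i j *
      (cov mu i j + (mean mu i + tnth u i) * (mean mu j + tnth u j))).
  apply: has_integral_sum => i; apply: has_integral_sum => j.
  exact/has_integralZ/moment2_has_integral.
congr has_integral: H; rewrite /qform -big_split/=; apply: eq_bigr => i _.
rewrite -big_split/=; apply: eq_bigr => j _.
by rewrite !tnth_mktuple; ring.
Qed.

Lemma cov_sym : (cov mu)^T = cov mu.
Proof.
apply/matrixP => i j; rewrite !mxE mulrC; congr (fine _ - _).
by apply: eq_integral => x _; rewrite mulrC.
Qed.

Hypothesis mu_hyperplane : forall H, is_hyperplane H -> (mu H < 1)%E.

(** The form at u is the variance of the linear functional u. If it vanished, mu would be carried by
    a hyperplane through the mean, against the bound on hyperplane masses. *)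
Lemma cov_posdef : posdef (cov mu).
Proof.
move=> u u0; pose m := vsub (vzero n) mean_vec.
pose B : 'M[R]_n := \matrix_(i, j) (tnth u i * tnth u j).
have BE x : qform B x = dotp u x ^+ 2.
  rewrite expr2 /dotp big_distrl/=; apply: eq_bigr => i _.
  by rewrite mulr_sumr; apply: eq_bigr => j _; rewrite mxE; ring.
have := qform_has_integral B m.
have -> : vadd mean_vec m = vzero n.
  by apply/eq_from_tnth => i; rewrite !tnth_mktuple; ring.
have -> : qform B (vzero n) = 0 by rewrite BE /dotp big1 ?expr0n// => i _; rewrite tnth_mktuple mulr0.
have -> : \sum_(i < n) \sum_(j < n) B i j * cov mu i j = qform (cov mu) u.
  by apply: eq_bigr => i _; apply: eq_bigr => j _; rewrite [B i j]mxE mulrC.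
rewrite add0r => -[_]; under eq_integral do rewrite BE.
move=> IE; rewrite lt_neqAle -lee_fin -IE integral_ge0 => [|x _]; last first.
  by rewrite lee_fin sqr_ge0.
rewrite andbT eq_sym; apply/negP => /eqP q0; rewrite q0 in IE.
have md : measurable_fun setT (fun x => (dotp u (vadd x m) ^+ 2)%:E).
  apply/measurable_EFinP; apply: measurable_funX.
  by apply: (measurableT_comp (measurable_dotp u)); exact: measurable_vadd.
have /(ae_eq_integral_abs mu measurableT md) : (\int[mu]_x `|(dotp u (vadd x m) ^+ 2)%:E| = 0)%E.
  by rewrite -[RHS]IE; apply: eq_integral => x _; rewrite gee0_abs// lee_fin sqr_ge0.
move=> [N [mN N0 subN]].
pose H := [set x | dotp u x = dotp u mean_vec].
have mH : measurable H by exact: measurable_hyperplane.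
have HN : ~` H `<=` N.
  move=> x Hx; apply: subN => /= /(_ Logic.I) [] /eqP.
  rewrite sqrf_eq0 dotpD => /eqP E; apply: Hx.
  have : dotp u m + dotp u mean_vec = 0.
    rewrite -dotpD /dotp big1// => i _; rewrite !tnth_mktuple; ring.
  by move=> E'; rewrite /H/=; move: E E'; lra.
have : (mu H < 1)%E by apply: mu_hyperplane; exists u, (dotp u mean_vec).
have : mu (~` H) = 0%E.
  apply/eqP; rewrite -measure_le0 -N0; apply: le_measure => //; rewrite inE//.
  exact: measurableC.
rewrite probability_setC// => H0.
rewrite ltNge; move=> /negP; apply.
by rewrite -sube_le0 H0.
Qed.

End covariance.

Section inverse_covariance.
Context {R : realType} {n : nat}.

Lemma qformE (B : 'M[R]_n) (x : vec R n) :
  qform B x = ((\col_i tnth x i)^T *m B *m (\col_i tnth x i)) 0 0.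
Proof.
rewrite mxE /qform exchange_big/=; apply: eq_bigr => j _.
rewrite [(_ *m B) _ _]mxE mulr_suml; apply: eq_bigr => i _; rewrite !mxE; ring.
Qed.

Lemma posdef_unitmx (C : 'M[R]_n) : C^T = C -> posdef C -> C \in unitmx.
Proof.
by move=> symC pC; rewrite unitmxE unitfE gt_eqF// posdef_det.
Qed.

(** Substituting x = C w turns the form of the inverse at x into the form of C at w. *)
Lemma invmx_posdef (C : 'M[R]_n) : C^T = C -> posdef C -> posdef (invmx C).
Proof.
move=> symC pC x x0; have uC := posdef_unitmx symC pC.
pose X : 'cV[R]_n := \col_i tnth x i; pose W := invmx C *m X.
pose w : vec R n := [tuple W i 0 | i < n].
have WE : \col_i tnth w i = W by apply/colP => i; rewrite mxE tnth_mktuple.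
have -> : qform (invmx C) x = qform C w.
  rewrite !qformE WE /W trmx_mul trmx_inv symC -/X !mulmxA.
  by rewrite -[X^T *m _ *m C]mulmxA mulVmx// mulmx1.
apply: pC; apply: contrapT => w0.
have W0 : W = 0.
  apply/colP => i; rewrite [RHS]mxE; apply/eqP/negPn/negP => Wi.
  by apply: w0; exists i; rewrite tnth_mktuple.
case: x0 => i /negP; apply; have : X i 0 = 0 by rewrite -[X](mulKVmx uC) -/W W0 mulmx0 mxE.
by rewrite mxE => ->.
Qed.

Lemma sum_invmx_mul (C : 'M[R]_n) : C^T = C -> C \in unitmx ->
  \sum_(i < n) \sum_(j < n) invmx C i j * C i j = n%:R.
Proof.
move=> symC uC; rewrite -[RHS]mxtrace1 -(mulVmx uC) /mxtrace.
apply: eq_bigr => i _; rewrite mxE; apply: eq_bigr => j _.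
by congr (_ * _); rewrite -[in LHS]symC mxE.
Qed.

End inverse_covariance.

(** * Expected half-space depth *)

Section monotone_integral.
Context d {T : measurableType d} {R : realType} (mu : {measure set T -> \bar R}).

(** The integral of a nonnegative function is a supremum over simple functions below it, hence
    monotone without measurability. This makes it applicable to the depth. *)
Lemma ge0_le_integral_nonmeasurable (f g : T -> \bar R) :
  (forall x, 0 <= f x)%E -> (forall x, f x <= g x)%E ->
  (\int[mu]_x f x <= \int[mu]_x g x)%E.
Proof.
move=> f0 fg; have g0 x : (0 <= g x)%E := le_trans (f0 x) (fg x).
rewrite !ge0_integralTE//; apply: ereal_sup_le => _ [h /= hf <-].
by exists h => // x; exact: le_trans (hf x) (fg x).
Qed.

End monotone_integral.

Section peak.
Context {R : realType} {n : nat}.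
Local Notation leb := (lebn (R := R) n).
Variables (M : R) (f : vec R n -> R) (mu : probability (vec R n) R).
Hypothesis fM : lc_density M f.
Hypothesis muf :
  forall A, measurable A -> (mu A = \int[lebn n]_(x in A) (f x)%:E)%E.
Hypothesis mu_hyperplane : forall H, is_hyperplane H -> (mu H < 1)%E.

Let f0 x : 0 <= f x. Proof. by case: fM => /(_ x)/andP[]. Qed.
Let mf : measurable_fun setT f. Proof. by case: fM. Qed.
Let lcf : lconcave f. Proof. by case: fM. Qed.
Let C := cov mu.
Let pC : posdef C. Proof. exact: cov_posdef f0 mf muf lcf mu_hyperplane. Qed.
Let symC : C^T = C. Proof. exact: cov_sym. Qed.
Let detC : 0 < \det C. Proof. exact: posdef_det. Qed.
Let B := invmx C.
Let pB : posdef B. Proof. exact: invmx_posdef. Qed.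
Let symB : B^T = B. Proof. by rewrite /B trmx_inv symC. Qed.

Let qform_ge0 x : 0 <= qform B x.
Proof.
have [x0|x0] := pselect (nonzero_vec x); first exact/ltW/pB.
rewrite /qform big1// => i _; apply: big1 => j _.
suff -> : tnth x i = 0 by rewrite mul0r mulr0.
by apply/eqP/negPn/negP => xi; apply: x0; exists i.
Qed.

Let moment u : (\int[leb]_x ((qform B (vadd x u))%:E * (f x)%:E) =
  (qform B (vadd (mean_vec mu) u) + n%:R)%:E)%E.
Proof.
have [_] := qform_has_integral f0 mf muf lcf B u.
rewrite sum_invmx_mul//; last exact: posdef_unitmx.
move=> <-; rewrite (integral_density (m := leb) f0 mf muf)//.
- apply/measurable_EFinP; apply: (measurableT_comp (measurable_qform B)).
  exact: measurable_vadd.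
- by move=> x; rewrite lee_fin.
Qed.

(* The Gaussian with covariance K C has F-average at least e^(-n/2), by the
   tangent line of exp at the F-average n of the exponent. *)
Lemma iter_conv_peak j : exists p,
  (2 * expR (n%:R / 2) * Num.sqrt (2 * pi) ^+ n *
    Num.sqrt ((2 ^ j)%:R ^+ n * \det (cov mu)))^-1 <= iter j conv f p.
Proof.
set peak := _^-1; set F := iter j conv f; have FM := iter_conv_lc_density fM j.
have F0 x : 0 <= F x by case: FM => /(_ x)/andP[].
have mF : measurable_fun setT F by case: FM.
have mEF : measurable_fun setT (fun x => (F x)%:E) by exact/measurable_EFinP.
apply: contrapT => /forallNP noP.
pose K : R := (2 ^ j)%:R; have K0 : 0 < K by rewrite ltr0n expn_gt0.
(* Recentres at the mean of F, which is K times that of mu; the F-average of Q is then K tr(C^(-1)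
   C) = n K. *)
pose u := vsub (vzero n) (vmuln (mean_vec mu) (2 ^ j)).
pose Q x := qform B (vadd x u).
have Q0 x : 0 <= Q x by exact: qform_ge0.
have mQ : measurable_fun setT Q.
  by apply: (measurableT_comp (measurable_qform B)); exact: measurable_vadd.
have IQ : (\int[leb]_x ((Q x)%:E * (F x)%:E) = (n%:R * K)%:E)%E.
  rewrite (iter_conv_moment fM j (ler0n _ n) qform_ge0 (measurable_qform B) moment).
  rewrite (_ : vadd _ u = vzero n); last first.
    by apply/eq_from_tnth => i; rewrite !tnth_mktuple; ring.
  rewrite (_ : qform B _ = 0) ?add0r ?mulr_natr//.
  by apply: big1 => i _; apply: big1 => k _; rewrite tnth_mktuple mul0r mulr0.
pose E x := expR (- (Q x / K) / 2).
have mE : measurable_fun setT E.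
  apply: measurableT_comp => //; apply: measurable_funM => //.
  by apply: measurableT_comp => //; exact: measurable_funM.
have mEE : measurable_fun setT (fun x => (E x)%:E) by exact/measurable_EFinP.
have mEQ : measurable_fun setT (fun x => (Q x)%:E) by exact/measurable_EFinP.
have E0 x : 0 <= E x by exact: expR_ge0.
have IE : (\int[leb]_x (E x)%:E = (Num.sqrt (2 * pi) ^+ n *
    Num.sqrt (K ^+ n * \det C))%:E)%E.
  have BK x : qform (K^-1 *: B) x = qform B x / K.
    rewrite /qform mulr_suml; apply: eq_bigr => i _; rewrite mulr_suml.
    by apply: eq_bigr => k _; rewrite mxE; ring.
  have pBK : posdef (K^-1 *: B) by move=> x x0; rewrite BK divr_gt0//; exact: pB.
  have symBK : (K^-1 *: B)^T = K^-1 *: B by rewrite linearZ/= symB.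
  have := gauss_integral symBK pBK.
  rewrite detZ det_inv exprVn -invfM sqrtrV ?invrK; last first.
    by rewrite mulr_ge0 ?exprn_ge0// ltW.
  move=> <-; rewrite -[RHS](integral_vadd u); last 2 first.
  - apply/measurable_EFinP; apply: measurableT_comp => //.
    apply: measurable_funM => //; apply: measurableT_comp => //.
    exact: measurable_qform.
  - by move=> x; rewrite lee_fin expR_ge0.
  by apply: eq_integral => x _; rewrite /E BK.
have F1 : (\int[leb]_x (F x)%:E = 1)%E by case: FM.
pose a := expR (n%:R / 2) : R; have a0 : 0 < a by exact: expR_gt0.
pose s : R := Num.sqrt (2 * pi) ^+ n; pose t := Num.sqrt (K ^+ n * \det C).
have s0 : 0 < s by rewrite exprn_gt0// sqrtr_gt0 mulr_gt0 ?pi_gt0.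
have t0 : 0 < t by rewrite sqrtr_gt0 mulr_gt0// exprn_gt0.
have peak0 : 0 < peak by rewrite invr_gt0 !mulr_gt0.
have IFE : (\int[leb]_x ((E x)%:E * (F x)%:E) <= (2^-1 / a)%:E)%E.
  apply: (@le_trans _ _ (\int[leb]_x ((peak)%:E * (E x)%:E))%E).
    apply: ge0_le_integral => //.
    - by move=> x _; rewrite mule_ge0 ?lee_fin ?expR_ge0.
    - by apply: emeasurable_funM => //; exact/measurable_EFinP.
    - by apply: measurable_funeM; exact/measurable_EFinP.
    - move=> x _; rewrite -!EFinM lee_fin mulrC ler_wpM2r ?expR_ge0//.
      by have /negP := noP x; rewrite -ltNge => /ltW.
  rewrite ge0_integralZl//; try by [rewrite lee_fin ltW|move=> x _; rewrite lee_fin].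
  rewrite IE -EFinM lee_fin /peak -/K -/a -/s -/t.
  rewrite le_eqVlt; apply/orP; left; apply/eqP; field.
  by rewrite !gt_eqF.
(* The tangent inequality a E + Q / (2K) >= 1 + n/2, integrated against F. The factor 2 in [peak]
   makes the average of a E at most 1/2, leaving the contradiction 1 <= 1/2. *)
have : ((1 + n%:R / 2)%:E <= (2^-1)%:E + (n%:R / 2)%:E :> \bar R)%E.
  apply: (@le_trans _ _ (\int[leb]_x ((1 + n%:R / 2)%:E * (F x)%:E))%E).
    rewrite ge0_integralZl ?F1 ?mule1//; try by move=> x _; rewrite lee_fin.
  apply: (@le_trans _ _ (\int[leb]_x (a%:E * ((E x)%:E * (F x)%:E) +
      ((K * 2)^-1)%:E * ((Q x)%:E * (F x)%:E)))%E).
    apply: ge0_le_integral => //.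
    - by move=> x _; rewrite -EFinM lee_fin mulr_ge0// addr_ge0// divr_ge0.
    - exact: measurable_funeM.
    - apply: emeasurable_funD; apply: measurable_funeM; apply: emeasurable_funM => //;
      exact/measurable_EFinP.
    - move=> x _; rewrite -!EFinM -EFinD lee_fin !mulrA -mulrDl ler_wpM2r//.
      rewrite -lerBlDr /a /E -expRD; apply: le_trans (expR_ge1Dx _).
      by rewrite le_eqVlt; apply/orP; left; apply/eqP; field; rewrite gt_eqF.
  rewrite ge0_integralD//; last 4 first.
  - by move=> x _; rewrite !mule_ge0 ?lee_fin ?expR_ge0.
  - by apply: measurable_funeM; apply: emeasurable_funM => //; exact/measurable_EFinP.
  - by move=> x _; rewrite !mule_ge0 ?lee_fin ?invr_ge0 ?mulr_ge0// ltW.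
  - by apply: measurable_funeM; apply: emeasurable_funM => //; exact/measurable_EFinP.
  have scale (c : R) (g : vec R n -> R) : 0 <= c -> (forall x, 0 <= g x) ->
      measurable_fun setT (fun x => (g x)%:E) ->
      (\int[leb]_x (c%:E * ((g x)%:E * (F x)%:E)) =
       c%:E * \int[leb]_x ((g x)%:E * (F x)%:E))%E.
    move=> c0 g0 mg; apply: ge0_integralZl; [by []|exact: emeasurable_funM
      |by move=> x _; rewrite mule_ge0 ?lee_fin|by rewrite lee_fin].
  have K20 : 0 <= (K * 2)^-1 by rewrite invr_ge0 mulr_ge0// ltW.
  rewrite (scale a _ (ltW a0))// (scale _ _ K20)//.
  apply: leeD.
    apply: le_trans (lee_wpmul2l _ IFE) _; first by rewrite lee_fin ltW.
    by rewrite -EFinM lee_fin mulrCA divff ?gt_eqF// mulr1.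
  rewrite IQ -EFinM lee_fin le_eqVlt; apply/orP; left; apply/eqP; field.
  by rewrite gt_eqF.
by rewrite -EFinD lee_fin lerD2r leNgt invf_lt1 ?ltr1n.
Qed.

End peak.

Section depth_bounds.
Context {R : realType} {m : nat}.
Local Notation n := m.+1.
Local Notation leb := (lebn (R := R) n).
Variables (M : R) (f : vec R n -> R) (mu : probability (vec R n) R).
Hypothesis fM : lc_density M f.
Hypothesis muf :
  forall A, measurable A -> (mu A = \int[lebn n]_(x in A) (f x)%:E)%E.

Let f0 x : 0 <= f x. Proof. by case: fM => /(_ x)/andP[]. Qed.
Let mf : measurable_fun setT f. Proof. by case: fM. Qed.
Let mEf : measurable_fun setT (fun x => (f x)%:E).
Proof. exact/measurable_EFinP. Qed.

Let muE A : measurable A -> (mu A = \int[leb]_x ((\1_A x)%:E * (f x)%:E))%E.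
Proof. exact: density_indic. Qed.
Let mI (D : set (vec R n)) : measurable D ->
  measurable_fun setT (fun y => (\1_D y)%:E : \bar R).
Proof. by move=> mD; apply/measurable_EFinP; exact: measurable_indic. Qed.

Lemma le_mass_volume A : measurable A -> (mu A <= M%:E * leb A)%E.
Proof.
move=> mA; have f_le x : f x <= M by case: fM => /(_ x)/andP[].
have M0 : 0 <= M := le_trans (f0 (vzero n)) (f_le (vzero n)).
rewrite muE//; apply: (@le_trans _ _ (\int[leb]_x (M%:E * (\1_A x)%:E))%E).
  apply: ge0_le_integral => //.
  - by move=> x _; rewrite mule_ge0 ?lee_fin.
  - by apply: emeasurable_funM => //; exact: mI.
  - by apply: measurable_funeM; exact: mI.
  - by move=> x _; rewrite muleC lee_wpmul2r ?lee_fin.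
rewrite ge0_integralZl ?lee_fin//; last exact: mI.
by rewrite integral_indic// setIT.
Qed.

Lemma depth_ge0 x : (0 <= tukey_depth mu x)%E.
Proof. by apply: le_ereal_inf_tmp => _ [H _ <-]. Qed.

Lemma depth_le u t x : nonzero_vec u -> t <= dotp u x ->
  (tukey_depth mu x <= mu [set y | (t <= dotp u y)%R])%E.
Proof.
move=> u0 tx; apply: ereal_inf_lbound; exists [set y | t <= dotp u y] => //.
by split => //; exists u, t.
Qed.

(** Two opposite closed half-spaces through x overlap in a null hyperplane, so their masses sum to
    at most 1. *)
Lemma depth_le_half x : (tukey_depth mu x <= (2^-1)%:E)%E.
Proof.
pose u : vec R n := vcons (1, vzero m); pose v : vec R n := vcons (-1, vzero m).
have u0 : nonzero_vec u by exists ord0; exact: oner_neq0.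
have v0 : nonzero_vec v by exists ord0; rewrite /= oppr_eq0 oner_neq0.
have vE y : dotp v y = - dotp u y.
  rewrite -(vunconsK y); case: (vuncons y) => s z.
  by rewrite !(dotp_vcons _ _ erefl) !dotp0v !addr0 mulN1r mul1r.
have Hu := depth_le u0 (lexx (dotp u x)); have Hv := depth_le v0 (lexx (dotp v x)).
set A := [set y | _ <= _] in Hu; set B := [set y | _ <= _] in Hv.
have mA : measurable A by exact: measurable_halfspace.
have mB : measurable B by exact: measurable_halfspace.
pose N := [set y | dotp u y = dotp u x].
have mN : measurable N by exact: measurable_hyperplane.
have N0 : mu N = 0%E.
  apply/eqP; rewrite -measure_le0; apply: le_trans (le_mass_volume mN) _.
  by rewrite [X in (_ * X)%E](lebn_hyperplane _ u0) mule0.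
have BA : B = ~` A `|` N.
  apply/seteqP; split => y; rewrite /A /B /N/= !vE lerN2.
    by rewrite le_eqVlt => /predU1P[->|yx]; [right|left; apply/negP; rewrite -ltNge].
  by case=> [/negP|->//]; rewrite -ltNge => /ltW.
have muB : (mu B <= 1 - mu A)%E.
  rewrite BA; apply: (@le_trans _ _ (mu (~` A) + mu N)%E).
    by apply: measureU2 => //; exact: measurableC.
  by rewrite N0 adde0 probability_setC.
have [a muA] : exists a, mu A = a%:E by exists (fine (mu A)); rewrite fineK// fin_num_measure.
rewrite muA -EFinB in muB; rewrite muA in Hu.
have := le_trans Hv muB; move: Hu; have := depth_ge0 x.
case: (tukey_depth mu x) => // t _; rewrite !lee_fin => ta ta'.
by lra.
Qed.

Lemma depth_le_off_level j p x : 0 < iter j conv f p ->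
  iter j conv f (vmuln x (2 ^ j)) < expR (- (4 * n%:R)) * iter j conv f p ->
  (tukey_depth mu x <= (expR (- (n%:R / (2 ^ j)%:R)))%:E)%E.
Proof.
(* This s gives r^K <= 2^n e^(-2n) <= e^(-n), because 2 <= e. *)
move=> Fp Fx; pose s : R := 2 * n%:R.
have sE : 4 * n%:R = s + s by rewrite /s; ring.
pose r u := fine (mu [set y | dotp u x <= dotp u y]).
have mur u : mu [set y | dotp u x <= dotp u y] = (r u)%:E.
  by rewrite /r fineK// fin_num_measure//; exact: measurable_halfspace.
rewrite sE in Fx; pose K : R := (2 ^ j)%:R.
have [u u0 off] := halfspace_off_level fM Fp Fx.
have H : r u ^+ (2 ^ j) <= 2 ^+ n * expR (- s).
  apply: off; first exact: fine_ge0.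
  by rewrite -muE -?mur//; exact: measurable_halfspace.
apply: le_trans (depth_le u0 (lexx _)) _; rewrite mur lee_fin.
have r0 : 0 <= r u by exact: fine_ge0.
have K0 : 0 < K by rewrite ltr0n expn_gt0.
rewrite leNgt; apply/negP => er.
have : expR (- n%:R) < r u ^+ (2 ^ j).
  have -> : - n%:R = (2 ^ j)%:R * (- (n%:R / K)) :> R.
    by rewrite -/K mulrN mulrC divfK// gt_eqF.
  by rewrite expRM_natl ltrXn2r ?expR_ge0// expn_eq0.
rewrite ltNge => /negP; apply; apply: le_trans H _.
have -> : - s = - n%:R + - n%:R by rewrite /s; ring.
rewrite expRD mulrA ler_piMl ?expR_ge0//.
rewrite expRN ler_pdivrMr ?expR_gt0// mul1r -[n%:R]mulr1 expRM_natl.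
by rewrite lerXn2r ?nnegrE ?expR_ge0//; have := expR_ge1Dx (1 : R).
Qed.

End depth_bounds.

Section expected_depth.
Context {R : realType} {m : nat}.
Local Notation n := m.+1.
Local Notation leb := (lebn (R := R) n).

(** Markov's inequality for x -> F(K x), whose integral is K^(-n). *)
Lemma level_volume (M : R) (F : vec R n -> R) (k : nat) (c : R) :
  lc_density M F -> (0 < k)%N -> 0 < c ->
  measurable [set x | c <= F (vmuln x k)] /\
  (leb [set x | (c <= F (vmuln x k))%R] <= ((k%:R ^+ n * c)^-1)%:E)%E.
Proof.
move=> FM k0 c0; have F0 x : 0 <= F x by case: FM => /(_ x)/andP[].
have mF : measurable_fun setT F by case: FM.
have F1 : (\int[leb]_x (F x)%:E = 1)%E by case: FM.
have K0 : (0 : R) < k%:R by rewrite ltr0n.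
have scaleE x : vmuln x k = vscale k%:R (vzero n) x.
  by apply/eq_from_tnth => i; rewrite !tnth_mktuple addr0 mulr_natl.
have mG : measurable_fun setT (fun x => F (vmuln x k)).
  under eq_fun do rewrite scaleE.
  by apply: (measurableT_comp mF); exact: measurable_vscale.
set D := mkset _; have mD : measurable D.
  rewrite (_ : D = (fun x => F (vmuln x k)) @^-1` `[c, +oo[%classic).
    by rewrite -[X in measurable X]setTI; exact: mG.
  by apply/seteqP; split => x /=; rewrite in_itv/= andbT.
split => //; set I := (\int[leb]_x (F (vmuln x k))%:E)%E.
have IE : ((k%:R ^+ n)%:E * I = 1)%E.
  rewrite -F1 (integral_vscale (vzero n) K0); last 2 first.
  - exact/measurable_EFinP.
  - by move=> x; rewrite lee_fin.
  by congr (_ * _)%E; apply: eq_integral => x _; rewrite scaleE.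
have cI : (c%:E * leb D <= I)%E.
  rewrite -[X in (_ * leb X)%E](setIT D) -integral_indic//.
  rewrite -ge0_integralZl ?lee_fin ?(ltW c0)//; last first.
    by apply/measurable_EFinP; exact: measurable_indic.
  rewrite /I; apply: ge0_le_integral => //.
  - by move=> x _; rewrite mule_ge0 ?lee_fin ?(ltW c0).
  - by apply: measurable_funeM; apply/measurable_EFinP; exact: measurable_indic.
  - exact/measurable_EFinP.
  - move=> x _; rewrite -EFinM lee_fin indicE.
    have [Dx|Dx] := pselect (D x); first by rewrite mem_set// mulr1.
    by rewrite memNset// mulr0.
have Kn0 : (0 : R) < k%:R ^+ n by exact: exprn_gt0.
have Kc0 : 0 < k%:R ^+ n * c by exact: mulr_gt0.
rewrite -(@lee_pmul2l _ (k%:R ^+ n * c)%:E)// -[leRHS]EFinM divff ?gt_eqF//.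
by rewrite -IE EFinM -muleA lee_pmul2l.
Qed.

Variables (M : R) (f : vec R n -> R) (mu : probability (vec R n) R).
Hypothesis fM : lc_density M f.
Hypothesis muf :
  forall A, measurable A -> (mu A = \int[lebn n]_(x in A) (f x)%:E)%E.
Hypothesis mu_hyperplane : forall H, is_hyperplane H -> (mu H < 1)%E.

Let M_ge0 : 0 <= M.
Proof. by case: fM => /(_ (vzero n))/andP[? ?] _ _ _; apply: le_trans; eassumption. Qed.

Lemma expected_depth_le (j : nat) (p : vec R n) : 0 < iter j conv f p ->
  (\int[mu]_x tukey_depth mu x <= (expR (- (n%:R / (2 ^ j)%:R)) +
    M / ((2 ^ j)%:R ^+ n * (expR (- (4 * n%:R)) * iter j conv f p)))%:E)%E.
Proof.
move=> Fp; set F := iter j conv f in Fp *; have FM := iter_conv_lc_density fM j.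
set c := expR (- _) * F p; have c0 : 0 < c by rewrite mulr_gt0 ?expR_gt0.
have k0 : (0 < 2 ^ j)%N by rewrite expn_gt0.
have [mD Dle] := level_volume FM k0 c0; set D := mkset _ in mD Dle.
set a := expR (- (n%:R / _)).
(* Off [D] the depth is at most [a]; on [D] it is at most 1/2, hence below the indicator. *)
apply: (@le_trans _ _ (\int[mu]_x (a%:E + (\1_D x)%:E))%E).
  apply: ge0_le_integral_nonmeasurable => [x|x]; first exact: depth_ge0.
  have [Dx|Dx] := pselect (D x).
    rewrite indicE mem_set//; apply: le_trans (depth_le_half fM muf x) _.
    rewrite -EFinD lee_fin; have := expR_ge0 (- (n%:R / (2 ^ j)%:R) : R).
    rewrite -/a => a0; apply: (@le_trans _ _ 1); last by rewrite lerDr.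
    by rewrite invf_le1// ler1n.
  have Fx : F (vmuln x (2 ^ j)) < c by rewrite ltNge; apply/negP.
  rewrite indicE memNset// adde0 /a; exact: (depth_le_off_level fM muf Fp Fx).
rewrite ge0_integralD//; last 2 first.
- by move=> x _; rewrite lee_fin expR_ge0.
- by apply/measurable_EFinP; exact: measurable_indic.
rewrite integral_indic// setIT EFinD; apply: leeD.
  rewrite (_ : (\int[mu]_x a%:E = \int[mu]_x (cst a%:E) x)%E)//.
  by rewrite integral_cst// [X in (_ * X)%E](probability_setT mu) mule1.
apply: le_trans (le_mass_volume fM muf mD) _.
by apply: le_trans (lee_wpmul2l _ Dle) _; rewrite ?lee_fin.
Qed.

Let C := cov mu.
Let detC : 0 < \det C.
Proof.
have [f0M mf f1 lcf] := fM.
have f0 x : 0 <= f x by case/andP: (f0M x).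
apply: posdef_det; first exact: cov_sym.
exact: cov_posdef f0 mf muf lcf mu_hyperplane.
Qed.

Variable L : R.
Hypothesis L0 : 0 <= L.
Hypothesis LE : L ^+ n = M * Num.sqrt (\det C).

(** 9/2 = 1/2 + 4: the 1/2 comes from the factor e^(-n/2) in the peak, the 4 from the level e^(-4n).
    The single factor 2 of the peak is at most 2^n. *)
Let A : R := 2 * expR (9 / 2) * Num.sqrt (2 * pi).

Let A_gt0 : 0 < A.
Proof. by rewrite !mulr_gt0 ?expR_gt0// sqrtr_gt0 mulr_gt0 ?pi_gt0. Qed.

Let AnE : 2 * (expR (9 / 2 * n%:R) * Num.sqrt (2 * pi) ^+ n) <= A ^+ n.
Proof.
rewrite /A !exprMn -(expRM_natr n (9 / 2)) -(mulrA (2 ^+ n)).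
apply: ler_wpM2r; first by rewrite mulr_ge0 ?expR_ge0// exprn_ge0.
by rewrite exprS ler_peMr// exprn_ege1// ler1n.
Qed.

(** The peak estimate without convolution, j = 0, compared with f <= M. It guarantees that the
    threshold for K is at least 1, as rounding to a power of two requires. *)
Lemma isotropic_constant_lower_bound : 1 <= A * L.
Proof.
have [p] := iter_conv_peak fM muf mu_hyperplane 0.
rewrite /= expn0 expr1n mul1r => fp.
have pM : f p <= M by case: fM => /(_ p)/andP[].
have s0 : 0 < Num.sqrt (2 * pi) :> R by rewrite sqrtr_gt0 mulr_gt0 ?pi_gt0.
have := le_trans fp pM; rewrite -/C; set s := Num.sqrt (2 * pi) in s0 *.
set q := 2 * _ * _; have q0 : 0 < q.
  by rewrite !mulr_gt0 ?expR_gt0// exprn_gt0.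
have d0 : 0 < Num.sqrt (\det C) by rewrite sqrtr_gt0.
have qd : 0 < q * Num.sqrt (\det C) by exact: mulr_gt0.
rewrite -[_^-1]mul1r ler_pdivrMr// => H.
have AL0 : 0 <= A * L by rewrite mulr_ge0// ltW.
rewrite -(@expr_ge1 _ n)// exprMn LE; apply: le_trans H _.
rewrite mulrCA; apply: ler_wpM2r; first by rewrite mulr_ge0 ?(ltW d0).
have sn0 : 0 <= s ^+ n by rewrite exprn_ge0// ltW.
apply: le_trans AnE; rewrite /q -(mulrA 2) ler_wpM2l// ler_wpM2r//.
by rewrite ler_expR; have := ler0n R n; lra.
Qed.

Lemma expected_depth_dyadic j : (expR 1 * A * L) ^+ 2 <= (2 ^ j)%:R ->
  (\int[mu]_x tukey_depth mu x <= (2 * expR (- (n%:R / (2 ^ j)%:R)))%:E)%E.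
Proof.
set K : R := (2 ^ j)%:R => YK.
have K0 : 0 < K by rewrite ltr0n expn_gt0.
have [p Fp] := iter_conv_peak fM muf mu_hyperplane j.
set F := iter j conv f in Fp; rewrite -/K -/C in Fp; set pk := _^-1 in Fp.
have s0 : 0 < Num.sqrt (2 * pi) :> R by rewrite sqrtr_gt0 mulr_gt0 ?pi_gt0.
have d0 : 0 < Num.sqrt (\det C) by rewrite sqrtr_gt0.
have KnD : 0 < Num.sqrt (K ^+ n * \det C) by rewrite sqrtr_gt0 mulr_gt0// exprn_gt0.
have pk0 : 0 < pk by rewrite invr_gt0 !mulr_gt0 ?expR_gt0 ?exprn_gt0.
have Fp0 := lt_le_trans pk0 Fp.
apply: le_trans (expected_depth_le Fp0) _; rewrite -/F -/K lee_fin.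
rewrite [leRHS]mulrDl mul1r lerD2l.
(* The volume term is at most (A L / sqrt K)^n <= e^(-n), and e^(-n) <= e^(-n/K) since K >= 1. *)
apply: (@le_trans _ _ (expR (- n%:R))); last first.
  rewrite ler_expR lerN2 ler_pdivrMr// ler_peMr// ler1n expn_gt0//.
pose q := Num.sqrt K; have q0 : 0 < q by rewrite sqrtr_gt0.
have qK : q ^+ 2 = K by rewrite sqr_sqrtr// ltW.
have qn : Num.sqrt (K ^+ n) = q ^+ n.
  by rewrite -qK -exprM mulnC exprM sqrtr_sqr ger0_norm// exprn_ge0// ltW.
have AL : expR 1 * A * L <= q.
  rewrite -(@ler_pXn2r _ 2)// ?nnegrE ?qK//; last exact: ltW.
  by rewrite !mulr_ge0 ?expR_ge0// ltW.
apply: (@le_trans _ _ (M / (K ^+ n * (expR (- (4 * n%:R)) * pk)))).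
  rewrite ler_wpM2l// lef_pV2 ?posrE ?mulr_gt0 ?exprn_gt0 ?expR_gt0//.
  by rewrite !ler_pM2l ?exprn_gt0 ?expR_gt0.
apply: (@le_trans _ _ ((A * L / q) ^+ n)); last first.
  rewrite -[n%:R]mulr1 -mulrN expRM_natl lerXn2r ?nnegrE ?expR_ge0//.
    by rewrite divr_ge0 ?mulr_ge0 ?(ltW A_gt0) ?(ltW q0).
  rewrite ler_pdivrMr// expRN ler_pdivlMl ?expR_gt0//.
  by rewrite mulrA.
rewrite (exprMn n (A * L)) (exprMn n A) exprVn LE.
have -> : M / (K ^+ n * (expR (- (4 * n%:R)) * pk)) =
    2 * (expR (9 / 2 * n%:R) * Num.sqrt (2 * pi) ^+ n) *
    (M * Num.sqrt (\det C)) / q ^+ n.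
  have Kn0 : 0 <= K ^+ n by rewrite exprn_ge0// ltW.
  rewrite /pk (sqrtrM _ Kn0) qn -qK -exprM mulnC exprM.
  have -> : expR (9 / 2 * n%:R) = expR (n%:R / 2) * expR (4 * n%:R) :> R.
    by rewrite -expRD; congr expR; field.
  rewrite expRN; have e1 := expR_gt0 (4 * n%:R : R); have e2 := expR_gt0 (n%:R / 2 : R).
  have qn0 : 0 < q ^+ n by exact: exprn_gt0.
  have sn0 : 0 < Num.sqrt (2 * pi) ^+ n :> R by exact: exprn_gt0.
  move: e1 e2 qn0 sn0 d0; set a1 := expR _; set a2 := expR _; set a3 := q ^+ n.
  set a4 := _ ^+ n; set a5 := Num.sqrt (\det C) => e1 e2 e3 e4 e5.
  by field; rewrite !gt_eqF.
apply: ler_wpM2r; first by rewrite invr_ge0 exprn_ge0// ltW.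
by apply: ler_wpM2r AnE; rewrite mulr_ge0// ltW.
Qed.

End expected_depth.

(** * Choice of constants and conclusion *)

Section arithmetic.
Context {R : realType}.

Lemma dyadic_between (Y : R) : 1 <= Y ->
  exists j, Y <= (2 ^ j)%:R /\ (2 ^ j)%:R <= 2 * Y.
Proof.
move=> Y1; have exj : exists j, Y <= (2 ^ j)%:R :> R.
  exists (Num.truncn Y).+1; apply: ltW; apply: lt_le_trans (truncnS_gt _) _.
  by rewrite ler_nat ltnW// ltn_expl.
have [[|j] Yj minj] := ex_minnP exj; first by exists 0; split=> //; rewrite expn0; lra.
exists j.+1; split => //; rewrite expnS natrM ler_pM2l// leNgt; apply/negP => Yj'.
by have := minj _ (ltW Yj'); rewrite ltnn.
Qed.

Lemma powR_root_exp (a r : R) (n : nat) : (a `^ r) ^+ n = a `^ (r * n%:R).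
Proof. by rewrite powRrM powR_mulrn// powR_ge0. Qed.

End arithmetic.

Section probability_bounds.
Context {R : realType} {m : nat}.
Variable mu : probability (vec R m.+1) R.

Lemma depth_le1 x : (tukey_depth mu x <= 1)%E.
Proof.
have u0 : nonzero_vec (vcons (1, vzero m) : vec R m.+1) by exists ord0; exact: oner_neq0.
apply: le_trans (depth_le mu u0 (lexx (dotp _ x))) _.
by apply: probability_le1; exact: measurable_halfspace.
Qed.

Lemma expected_depth_le_cst (a : R) : (forall x, tukey_depth mu x <= a%:E)%E ->
  (\int[mu]_x tukey_depth mu x <= a%:E)%E.
Proof.
move=> phia; apply: (@le_trans _ _ (\int[mu]_x (cst a%:E) x)%E).
  by apply: ge0_le_integral_nonmeasurable => x //; exact: depth_ge0.
by rewrite integral_cst// [X in (_ * X)%E](probability_setT mu) mule1.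
Qed.

End probability_bounds.

Theorem theorem1p1 (R : realType) :
  exists (c : R) (n0 : nat), 0 < c /\
    forall (n : nat), (n0 <= n)%N ->
    forall (leb : {measure set (vec R n) -> \bar R}), is_lebesgue leb ->
    forall (mu : probability (vec R n) R) (f : vec R n -> R),
      log_concave_measure mu -> is_density leb mu f -> log_concave_fun f ->
      (\int[mu]_x tukey_depth mu x <=
        (expR (- (c * n%:R) / (isotropic_constant mu f) ^+ 2))%:E)%E.
Proof.
pose A : R := expR 1 * (2 * expR (9 / 2) * Num.sqrt (2 * pi)).
have A0 : 0 < A by rewrite !mulr_gt0 ?expR_gt0// sqrtr_gt0 mulr_gt0 ?pi_gt0.
(* [A] contains the extra e of the threshold in [expected_depth_dyadic]. One factor 2 in the 4 pays
   for rounding K to a power of two, the other for the prefactor of 2 e^(-n/K). Dimension 0 is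
   excluded since it has no half-spaces. *)
exists (4 * A ^+ 2)^-1, 1%N; split; first by rewrite invr_gt0 mulr_gt0// exprn_gt0.
move=> [//|m] _ leb lebE mu f [_ mu_hyp] [f0 [mf mudens]] lcf.
set L := isotropic_constant mu f.
have muf B : measurable B -> (mu B = \int[lebn m.+1]_(x in B) (f x)%:E)%E.
  by move=> mB; rewrite mudens// (integral_lebesgue _ _ lebE).
have [supf|nsupf] := pselect (has_sup (range f)); last first.
  (* For unbounded f the real [sup] defaults to 0, so L = 0; division by zero then makes the
     exponent 0 and the claimed bound 1. *)
  have -> : L = 0.
    by rewrite /L /isotropic_constant sup_out// powR0 ?mul0r// invr_eq0 pnatr_eq0.
  rewrite expr0n invr0 mulr0 expR0; apply: expected_depth_le_cst => x.
  exact: depth_le1.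
set M := sup (range f).
have fM : lc_density M f.
  split => //; last exact: log_concave_fun_lconcave.
    by move=> x; rewrite f0/=; apply: sup_upper_bound => //; exists x.
  by rewrite -muf// probability_setT.
have M0 : 0 <= M by case: fM => /(_ (vzero m.+1))/andP[? ?] _ _ _; apply: le_trans; eassumption.
have L0 : 0 <= L by rewrite mulr_ge0// powR_ge0.
have detC : 0 < \det (cov mu).
  apply: posdef_det; first exact: cov_sym.
  apply: cov_posdef f0 mf muf _ mu_hyp.
  exact: log_concave_fun_lconcave.
have LE : L ^+ m.+1 = M * Num.sqrt (\det (cov mu)).
  rewrite /L /isotropic_constant exprMn !powR_root_exp mulVf ?pnatr_eq0//.
  rewrite powRr1// -powR12_sqrt ?ltW//; congr (_ * _ `^ _).
  by rewrite natrM invfM -mulrA mulVf ?mulr1// pnatr_eq0.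
have AL : 1 <= A * L.
  have := isotropic_constant_lower_bound fM muf mu_hyp L0 LE.
  move=> AL; apply: le_trans AL _; rewrite /A -[leRHS]mulrA.
  apply: ler_peMl; last by have := expR_ge1Dx (1 : R); lra.
  by do 3 apply: mulr_ge0 => //; exact: expR_ge0.
pose Y := (A * L) ^+ 2; have Y1 : 1 <= Y by exact: exprn_ege1.
have Y0 : 0 < Y := lt_le_trans ltr01 Y1.
have Lpos : L != 0 by apply/eqP => L00; move: AL; rewrite L00 mulr0 ler10.
have -> : - ((4 * A ^+ 2)^-1 * m.+1%:R) / L ^+ 2 = - (m.+1%:R / (4 * Y)).
  by rewrite /Y; field; rewrite Lpos gt_eqF.
set delta := _ / (4 * Y).
have [j [Yj jY]] := dyadic_between Y1.
(* 2 e^(-2 delta) <= e^(-delta) holds exactly when delta >= ln 2; below that threshold e^(-delta)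
   exceeds 1/2. *)
have [large|small] := leP (ln 2) delta; last first.
  apply: (@le_trans _ _ (2^-1)%:E).
    by apply: expected_depth_le_cst => x; exact: depth_le_half fM muf x.
  by rewrite lee_fin -[leLHS]lnK ?posrE ?invr_gt0// ler_expR lnV ?posrE// lerN2 ltW.
apply: le_trans (expected_depth_dyadic fM muf mu_hyp L0 LE Yj) _.
rewrite lee_fin -[X in X * _]lnK ?posrE// -expRD ler_expR.
have : 2 * delta <= m.+1%:R / (2 ^ j)%:R.
  have -> : 2 * delta = m.+1%:R / (2 * Y) by rewrite /delta; field; rewrite gt_eqF.
  have k0 : (0 : R) < (2 ^ j)%:R by rewrite ltr0n expn_gt0.
  have y0 : 0 < 2 * Y by rewrite mulr_gt0.
  by rewrite ler_pM2l ?ltr0n// lef_pV2 ?posrE.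
by lra.
Qed.
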